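(* Let $\alpha$ be a composition of $n$ and $\sigma\in\mathfrak{S}_{\ell(\alpha)}$, where $\ell(\alpha)$ is the number of parts of $\alpha$. For each $E\in\mathcal{E}^\sigma(\alpha)$, there is an isomorphism of $H_n(0)$-modules $$\mathbf{S}^\sigma_{\alpha,E}\cong\mathsf{B}\big(\underline{\mathsf{read}}(\tau_E),\underline{\mathsf{read}}(\tau'_E)\big),$$ where the words are viewed as permutations in one-line notation.
   Context: Permutations in $\mathfrak{S}_n$ are composed as functions; $s_i=(i,i+1)$; $\ell$ is the Coxeter length; $\mathrm{Des}_L(\gamma)=\{i\mid \ell(s_i\gamma)<\ell(\gamma)\}$. Left weak Bruhat order: $\xi\preceq_L\rho$ iff $\rho=\gamma\xi$ with $\ell(\rho)=\ell(\gamma)+\ell(\xi)$ for some $\gamma$; $[\xi,\rho]_L=\{\gamma\mid\xi\preceq_L\gamma\preceq_L\rho\}$. $H_n(0)$ is the unital $\mathbb{C}$-algebra generated by $\pi_1,\dots,\pi_{n-1}$ with relations $\pi_i^2=\pi_i$, $\pi_i\pi_{i+1}\pi_i=\pi_{i+1}\pi_i\pi_{i+1}$, $\pi_i\pi_j=\pi_j\pi_i$ for $|i-j|\ge2$; $\pi_\gamma$ is the product of the $\pi_i$ along any reduced expression of $\gamma$. $\mathsf{B}(\xi,\rho)$ is the left $H_n(0)$-module with basis $[\xi,\rho]_L$ and action: $\pi_i\cdot\gamma=\gamma$ if $i\in\mathrm{Des}_L(\gamma)$; $0$ if $i\notin\mathrm{Des}_L(\gamma)$ and $s_i\gamma\notin[\xi,\rho]_L$;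 $s_i\gamma$ if $i\notin\mathrm{Des}_L(\gamma)$ and $s_i\gamma\in[\xi,\rho]_L$. The composition diagram of $\alpha=(\alpha_1,\dots,\alpha_k)$ is the left-justified array of boxes whose $i$th row from the top has $\alpha_i$ boxes; box $(i,j)$ is in row $i$ from the top and column $j$ from the left, and $\tau_{i,j}$ is the entry of a filling $\tau$ there. A standard permuted composition tableau of shape $\alpha$ and type $\sigma$ is a filling $\tau$ of this diagram with $1,\dots,n$ such that: (1) entries are all distinct; (2) the standardization of the word obtained by reading the first column from top to bottom is $\sigma$; (3) entries in each row decrease from left to right; (4) if $i<j$ and $\tau_{i,k}>\tau_{j,k+1}$, then $(i,k+1)$ is a box of the diagram and $\tau_{i,k+1}>\tau_{j,k+1}$. The set of these is $\mathrm{SPCT}^\sigma(\alpha)$. $\mathbf{S}^\sigma_\alpha$ is the $H_n(0)$-module with basis $\mathrm{SPCT}^\sigma(\alpha)$ and action: $\pi_i\cdot\tau=\tau$ if $i+1$ is strictly left of $i$ in $\tau$; if $i+1$ is weakly right of $i$, then $\pi_i\cdot\tau=0$ when $i$ and $i+1$ are attacking, i.e. they are in the same column, or $i+1$ is in the column immediately to the right of that of $i$ and in a strictly lower row; otherwise $\pi_i\cdot\tau$ is $\tau$ with $i$ and $i+1$ swapped. For $\tau,\tau'\in\mathrm{SPCT}^\sigma(\alpha)$, $\tau\sim\tau'$ means that for every $k$ the relative order of the entries of the $k$th column is the same in $\tau$ and $\tau'$. $\mathcal{E}^\sigma(\alpha)$ is the set of equivalence classes; for $E\in\mathcal{E}^\sigma(\alpha)$,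 $E\cup\{0\}$ is closed under the action, and $\mathbf{S}^\sigma_{\alpha,E}$ is the submodule spanned by $E$. Each class $E$ has a unique source $\tau_E\in E$ (for every $\tau\in E$ there is $\gamma\in\mathfrak{S}_n$ with $\pi_\gamma\cdot\tau_E=\tau$) and a unique sink $\tau'_E\in E$ (for every $\tau\in E$ there is $\gamma\in\mathfrak{S}_n$ with $\pi_\gamma\cdot\tau=\tau'_E$). Reading word: let $\{d_1<\cdots<d_p\}$ be the set of $i\in[n-1]$ such that $i+1$ lies weakly right of $i$ in $\tau_E$, and $d_0=0$, $d_{p+1}=n$. For $1\le j\le p+1$ let $\mathtt{H}_j$ be the set of boxes (a horizontal strip) containing the entries $d_{j-1}+1,\dots,d_j$ in $\tau_E$. For $\tau\in E$, let $\mathrm{w}^{(j)}(\tau)$ be the word obtained by reading the entries of $\tau$ in the boxes of $\mathtt{H}_j$ from left to right, and $\underline{\mathsf{read}}(\tau)=\mathrm{w}^{(1)}(\tau)\,\mathrm{w}^{(2)}(\tau)\cdots\mathrm{w}^{(p+1)}(\tau)$. *)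

(* Defs.v *)
From HB Require Import structures.
From mathcomp Require Import all_boot all_order all_fingroup all_algebra.
From mathcomp Require Import boolp reals.
From mathcomp.real_closed Require Import complex.
From mathcomp Require Import zify.

Set Implicit Arguments.
Unset Strict Implicit.
Unset Printing Implicit Defensive.

Import GRing.Theory.
Local Open Scope quotient_scope.
Local Open Scope ring_scope.

(* H_n(0) by generators and relations: terms of the language of unital
   K-algebras in the letters pi_i, modulo the least congruence containing the
   K-algebra axioms and the 0-Hecke relations.  HScal c is c times the unit.
   Indices are 0-based: the letter i : 'I_n.-1 is pi_{i+1}, and the elements
   of 'I_n stand for 1, ..., n. *)
Section HeckeAlgebra.
Variables (K : fieldType) (n : nat).

Inductive hterm : Type :=
| HGen of 'I_n.-1
| HScal of K
| HAdd of hterm & hterm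
| HMul of hterm & hterm.

Local Notation "a +h b" := (HAdd a b) (at level 50, left associativity).
Local Notation "a *h b" := (HMul a b) (at level 40, left associativity).

Inductive heq : hterm -> hterm -> Prop :=
| heq_refl a : heq a a
| heq_sym a b : heq a b -> heq b a
| heq_trans b a c : heq a b -> heq b c -> heq a c
| heq_add a a' b b' : heq a a' -> heq b b' -> heq (a +h b) (a' +h b')
| heq_mul a a' b b' : heq a a' -> heq b b' -> heq (a *h b) (a' *h b')
| heq_addA a b c : heq (a +h (b +h c)) (a +h b +h c)
| heq_addC a b : heq (a +h b) (b +h a)
| heq_add0 a : heq (HScal 0 +h a) a
| heq_addN a : heq (HScal (- 1) *h a +h a) (HScal 0)
| heq_mulA a b c : heq (a *h (b *h c)) (a *h b *h c)
| heq_mul1 a : heq (HScal 1 *h a) a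
| heq_mulDl a b c : heq ((a +h b) *h c) (a *h c +h b *h c)
| heq_mulDr a b c : heq (a *h (b +h c)) (a *h b +h a *h c)
| heq_scalD x y : heq (HScal (x + y)) (HScal x +h HScal y)
| heq_scalM x y : heq (HScal (x * y)) (HScal x *h HScal y)
| heq_scalC x a : heq (HScal x *h a) (a *h HScal x)
| heq_idem i : heq (HGen i *h HGen i) (HGen i)
| heq_braid (i j : 'I_n.-1) : j = i.+1 :> nat ->
    heq (HGen i *h HGen j *h HGen i) (HGen j *h HGen i *h HGen j)
| heq_comm (i j : 'I_n.-1) : (i.+2 <= j)%N ->
    heq (HGen i *h HGen j) (HGen j *h HGen i).

Definition heqb : rel {classic hterm} := fun a b => `[< heq a b >].

Lemma heqb_equiv : equiv_class_of heqb.
Proof.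
split=> [a | a b | b a c].
- by apply/asboolP; apply: heq_refl.
- by apply/asboolP/asboolP; apply: heq_sym.
- by move=> /asboolP h1 /asboolP h2; apply/asboolP; apply: heq_trans h1 h2.
Qed.
Canonical heqb_equiv_rel := EquivRelPack heqb_equiv.

Definition hecke : Type := {eq_quot heqb_equiv_rel}.
HB.instance Definition _ := EqQuotient.on hecke.
HB.instance Definition _ := Choice.on hecke.

Definition hcl (t : hterm) : hecke := \pi_hecke (t : {classic hterm}).
Definition hrep (x : hecke) : hterm := generic_quotient.repr x.

Lemma hclP a b : hcl a = hcl b <-> heq a b.
Proof.
rewrite /hcl; split=> [/eqmodP /asboolP //|h].
by apply/eqmodP/asboolP.
Qed.
Lemma hrepK x : hcl (hrep x) = x.
Proof. exact: reprK. Qed.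
Lemma hclK a : heq (hrep (hcl a)) a.
Proof. by apply/hclP; rewrite hrepK. Qed.

Definition hecke_add x y := hcl (hrep x +h hrep y).
Definition hecke_opp x := hcl (HScal (- 1) *h hrep x).
Definition hecke_mul x y := hcl (hrep x *h hrep y).

Lemma hcl_add a b : hecke_add (hcl a) (hcl b) = hcl (a +h b).
Proof. by apply/hclP/heq_add; apply: hclK. Qed.
Lemma hcl_mul a b : hecke_mul (hcl a) (hcl b) = hcl (a *h b).
Proof. by apply/hclP/heq_mul; apply: hclK. Qed.
Lemma hcl_opp a : hecke_opp (hcl a) = hcl (HScal (- 1) *h a).
Proof. by apply/hclP/heq_mul; [apply: heq_refl | apply: hclK]. Qed.

Lemma hcl_ind (P : hecke -> Prop) : (forall a, P (hcl a)) -> forall x, P x.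
Proof. by move=> h x; rewrite -(hrepK x). Qed.

Lemma hecke_addA : associative hecke_add.
Proof.
elim/hcl_ind=> a; elim/hcl_ind=> b; elim/hcl_ind=> c.
by rewrite !hcl_add; apply/hclP/heq_addA.
Qed.
Lemma hecke_addC : commutative hecke_add.
Proof.
by elim/hcl_ind=> a; elim/hcl_ind=> b; rewrite !hcl_add; apply/hclP/heq_addC.
Qed.
Lemma hecke_add0 : left_id (hcl (HScal 0)) hecke_add.
Proof. by elim/hcl_ind=> a; rewrite !hcl_add; apply/hclP/heq_add0. Qed.
Lemma hecke_addN : left_inverse (hcl (HScal 0)) hecke_opp hecke_add.
Proof. by elim/hcl_ind=> a; rewrite hcl_opp hcl_add; apply/hclP/heq_addN. Qed.
Lemma hecke_mulA : associative hecke_mul.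
Proof.
elim/hcl_ind=> a; elim/hcl_ind=> b; elim/hcl_ind=> c.
by rewrite !hcl_mul; apply/hclP/heq_mulA.
Qed.
Lemma hecke_mul1 : left_id (hcl (HScal 1)) hecke_mul.
Proof. by elim/hcl_ind=> a; rewrite !hcl_mul; apply/hclP/heq_mul1. Qed.
Lemma hecke_mulr1 : right_id (hcl (HScal 1)) hecke_mul.
Proof.
elim/hcl_ind=> a; rewrite !hcl_mul; apply/hclP.
exact: heq_trans (heq_sym (heq_scalC _ _)) (heq_mul1 _).
Qed.
Lemma hecke_mulDl : left_distributive hecke_mul hecke_add.
Proof.
elim/hcl_ind=> a; elim/hcl_ind=> b; elim/hcl_ind=> c.
by rewrite !(hcl_add, hcl_mul); apply/hclP/heq_mulDl.
Qed.
Lemma hecke_mulDr : right_distributive hecke_mul hecke_add.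
Proof.
elim/hcl_ind=> a; elim/hcl_ind=> b; elim/hcl_ind=> c.
by rewrite !(hcl_add, hcl_mul); apply/hclP/heq_mulDr.
Qed.

HB.instance Definition _ := GRing.isZmodule.Build hecke
  hecke_addA hecke_addC hecke_add0 hecke_addN.

(* The trivial character, every pi_i being sent to 0: it shows 1 != 0. *)
Fixpoint heval0 (t : hterm) : K :=
  match t with
  | HGen _ => 0
  | HScal c => c
  | HAdd a b => heval0 a + heval0 b
  | HMul a b => heval0 a * heval0 b
  end.
Lemma heval0_eq a b : heq a b -> heval0 a = heval0 b.
Proof.
elim=> //=.
- by move=> ? ? ? _ -> _ ->.
- by move=> ? ? ? ? _ -> _ ->.
- by move=> ? ? ? ? _ -> _ ->.
- by move=> *; rewrite addrA.
- by move=> *; rewrite addrC.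
- by move=> *; rewrite add0r.
- by move=> *; rewrite mulN1r addNr.
- by move=> *; rewrite mulrA.
- by move=> *; rewrite mul1r.
- by move=> *; rewrite mulrDl.
- by move=> *; rewrite mulrDr.
- by move=> *; rewrite mulrC.
- by move=> *; rewrite mulr0.
Qed.
Lemma hecke_1neq0 : hcl (HScal 1) != 0 :> hecke.
Proof.
apply/eqP => /(@hclP _ (HScal 0)) /heval0_eq /= /eqP.
by rewrite oner_eq0.
Qed.

HB.instance Definition _ := GRing.Zmodule_isNzRing.Build hecke
  hecke_mulA hecke_mul1 hecke_mulr1 hecke_mulDl hecke_mulDr hecke_1neq0.

Lemma hclD a b : hcl a + hcl b = hcl (a +h b).
Proof. exact: hcl_add. Qed.
Lemma hclM a b : hcl a * hcl b = hcl (a *h b).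
Proof. exact: hcl_mul. Qed.
Lemma hcl1 : hcl (HScal 1) = 1.
Proof. by []. Qed.

Definition hecke_scale (c : K) (x : hecke) : hecke := hcl (HScal c) * x.

Lemma hecke_scaleA a b v :
  hecke_scale a (hecke_scale b v) = hecke_scale (a * b) v.
Proof.
rewrite /hecke_scale mulrA hclM; congr (_ * _).
exact/hclP/heq_sym/heq_scalM.
Qed.
Lemma hecke_scale1 : left_id 1 hecke_scale.
Proof. by move=> x; rewrite /hecke_scale hcl1 mul1r. Qed.
Lemma hecke_scaleDr : right_distributive hecke_scale +%R.
Proof. by move=> c x y; rewrite /hecke_scale mulrDr. Qed.
Lemma hecke_scaleDl v : {morph hecke_scale^~ v : a b / a + b}.
Proof.
move=> a b; rewrite /hecke_scale -mulrDl hclD; congr (_ * _).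
exact/hclP/heq_scalD.
Qed.
HB.instance Definition _ := GRing.Zmodule_isLmodule.Build K hecke
  hecke_scaleA hecke_scale1 hecke_scaleDr hecke_scaleDl.

Lemma hecke_scaleAl (c : K) (u v : hecke) : c *: (u * v) = (c *: u) * v.
Proof. exact: mulrA. Qed.
HB.instance Definition _ := GRing.Lmodule_isLalgebra.Build K hecke
  hecke_scaleAl.
Lemma hecke_scaleAr (c : K) (u v : hecke) : c *: (u * v) = u * (c *: v).
Proof.
rewrite [LHS]mulrA [RHS]mulrA; congr (_ * _).
by elim/hcl_ind: u => a; rewrite !hclM; apply/hclP/heq_scalC.
Qed.
HB.instance Definition _ := GRing.Lalgebra_isAlgebra.Build K hecke
  hecke_scaleAr.

Definition hpi (i : 'I_n.-1) : hecke := hcl (HGen i).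

Lemma hpi_idem i : hpi i * hpi i = hpi i.
Proof. by rewrite /hpi !hclM; apply/hclP; apply: heq_idem. Qed.
Lemma hpi_braid (i j : 'I_n.-1) : j = i.+1 :> nat ->
  hpi i * hpi j * hpi i = hpi j * hpi i * hpi j.
Proof. by move=> ij; rewrite /hpi !hclM; apply/hclP; apply: heq_braid. Qed.
Lemma hpi_comm (i j : 'I_n.-1) : (i.+2 <= j)%N -> hpi i * hpi j = hpi j * hpi i.
Proof. by move=> ij; rewrite /hpi !hclM; apply/hclP; apply: heq_comm. Qed.

End HeckeAlgebra.

(* Permutations are composed as functions, whereas (g * h)%g applies g first. *)
Notation "g \oS h" := (h * g)%g (at level 40, left associativity).

Ltac case_if :=
  match goal with
  | |- context [if ?b then _ else _] =>
    lazymatch b with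
    | context [if _ then _ else _] => fail
    | _ => case: (boolP b) => ?
    end
  end.

Section Symmetric.
Variable n : nat.
Implicit Types (i j : 'I_n.-1) (g h : 'S_n) (w : seq 'I_n.-1).

Definition lo i : 'I_n := widen_ord (leq_pred n) i.
Lemma hi_subproof i : (i.+1 < n)%N.
Proof. by case: i => i /= h; lia. Qed.
Definition hi i : 'I_n := Ordinal (hi_subproof i).

Definition sref i : 'S_n := tperm (lo i) (hi i).
Definition word_perm w : 'S_n := foldr (fun i g => sref i \oS g) 1%g w.

Lemma lo_neq_hi i : lo i != hi i.
Proof. by rewrite -val_eqE /=; lia. Qed.
Lemma srefK i : (sref i * sref i = 1)%g.
Proof. exact: tperm2. Qed.
Lemma srefKc i g : sref i \oS (sref i \oS g) = g.
Proof. by rewrite -mulgA srefK mulg1. Qed.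
Lemma srefE i (x : 'I_n) :
  sref i x = (if x == lo i then hi i else if x == hi i then lo i else x) :> 'I_n.
Proof. by rewrite /sref; case: tpermP => [->|->|/eqP/negPf-> /eqP/negPf->];
  rewrite ?eqxx // eq_sym (negPf (lo_neq_hi i)). Qed.
Lemma sref_involutive i : involutive (sref i).
Proof. by move=> x; rewrite -permM srefK perm1. Qed.

Definition inv_set g :=
  [set p : 'I_n * 'I_n | (p.1 < p.2)%N && (g^-1%g p.2 < g^-1%g p.1)%N].
Definition ninv g := #|inv_set g|.

Lemma sref_lt i (x y : 'I_n) : (x, y) != (lo i, hi i) -> (x < y)%N ->
  (sref i x < sref i y)%N.
Proof.
rewrite !srefE xpair_eqE -!val_eqE /= => h1 h2.
by case: ifP => h3; case: ifP => h4 //=; try case: ifP => h5 //=;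
  try case: ifP => h6 //=; move: h1 h2 h3 h4; try move: h5; try move: h6; lia.
Qed.

Lemma ninv_sref i g : (g^-1%g (lo i) < g^-1%g (hi i))%N ->
  ninv (sref i \oS g) = (ninv g).+1.
Proof.
move=> asc.
have invE x : ((sref i \oS g)^-1)%g x = g^-1%g (sref i x).
  by rewrite invMg permM /sref tpermV.
have inD : (lo i, hi i) \in inv_set (sref i \oS g).
  by rewrite inE /= !invE ltnSn /sref tpermL tpermR.
have ninD : (lo i, hi i) \notin inv_set g.
  by rewrite inE /= ltnSn /=; lia.
rewrite /ninv (cardsD1 (lo i, hi i)) inD add1n; congr _.+1.
pose f (p : 'I_n * 'I_n) := (sref i p.1, sref i p.2).
have fK : involutive f by case=> x y; rewrite /f /= !sref_involutive.
rewrite -(card_imset _ (inv_inj fK)); apply: eq_card => -[x y].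
rewrite -[(x, y)]fK mem_imset; last exact: inv_inj fK.
rewrite [f (x, y)]/f !inE /= !invE !sref_involutive.
case: (altP ((sref i x, sref i y) =P (lo i, hi i))) => [e|ne] /=.
  case: e => e1 e2.
  have -> : x = hi i by rewrite -(sref_involutive i x) e1 /sref tpermL.
  have -> : y = lo i by rewrite -(sref_involutive i y) e2 /sref tpermR.
  by rewrite /= ltnNge leqnSn.
case: (altP ((x, y) =P (lo i, hi i))) => [[-> ->]|ne'].
  rewrite /sref tpermL tpermR /= ltnSn /= [(_.+1 < _)%N]ltnNge leqnSn /=.
  by symmetry; apply/negbTE; rewrite -leqNgt ltnW.
congr (_ && _); apply/idP/idP => h; last exact: sref_lt.
by have := sref_lt ne h; rewrite !sref_involutive.
Qed.

Lemma sref_invE i g x : ((sref i \oS g)^-1)%g x = g^-1%g (sref i x).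
Proof. by rewrite invMg permM /sref tpermV. Qed.

Lemma lo_hi_neq g i : (g (lo i) : nat) != g (hi i).
Proof. by rewrite val_eqE (inj_eq perm_inj) lo_neq_hi. Qed.

Lemma ninv_sref_desc i g : (g^-1%g (hi i) < g^-1%g (lo i))%N ->
  ninv g = (ninv (sref i \oS g)).+1.
Proof.
move=> des; have := @ninv_sref i (sref i \oS g).
by rewrite srefKc !sref_invE /sref tpermL tpermR; apply.
Qed.

Lemma ninv_le_sref i g : (ninv (sref i \oS g) <= (ninv g).+1)%N.
Proof.
case: (ltngtP (g^-1%g (lo i)) (g^-1%g (hi i))) => h.
- by rewrite ninv_sref.
- by rewrite (ninv_sref_desc h); lia.
- by have := lo_hi_neq g^-1%g i; rewrite h eqxx.
Qed.

Lemma ninv1 : ninv 1%g = 0%N.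
Proof.
apply/eqP; rewrite cards_eq0; apply/eqP/setP => -[x y].
by rewrite !inE /= invg1 !perm1; lia.
Qed.

Lemma no_desc_id g : (forall i, (g (lo i) < g (hi i))%N) -> g = 1%g.
Proof.
move=> asc.
have mono d (x y : 'I_n) : y = (x + d)%N :> nat -> (g x + d <= g y)%N.
  elim: d y => [|d IH] y e; first by rewrite addn0 (_ : y = x) //; apply: ord_inj; rewrite e addn0.
  have lt1 : ((x + d)%N < n.-1)%N by have := ltn_ord y; lia.
  pose i := Ordinal lt1.
  have := asc i; have -> : hi i = y by apply: ord_inj; rewrite /= e addnS.
  by have := IH (lo i) erefl; lia.
apply/permP => x; rewrite perm1; apply: val_inj => /=.
have n0 : (0 < n)%N by have := ltn_ord x; lia.
have nm : (n.-1 < n)%N by lia.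
have h1 := mono x (Ordinal n0) x erefl.
have := mono (n.-1 - x)%N x (Ordinal nm).
have := ltn_ord x; have := ltn_ord (g (Ordinal nm)); move: h1 => /=; lia.
Qed.

Lemma word_permP g : exists2 w, word_perm w = g & size w = ninv g.
Proof.
have [m] := ubnP (ninv g); elim: m g => // m IH g lt.
case: (pickP (fun i => (g^-1%g (hi i) < g^-1%g (lo i))%N)) => [i des|asc].
  have e := ninv_sref_desc des.
  have [|w gw sz] := IH (sref i \oS g); first by lia.
  by exists (i :: w); rewrite /= ?gw ?srefKc // sz e.
have -> : g = 1%g.
  apply: invg_inj; rewrite invg1; apply: no_desc_id => i.
  have /negbT := asc i; rewrite -leqNgt leq_eqVlt => /orP [/eqP e|//].
  by have := lo_hi_neq g^-1%g i; rewrite e eqxx.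
by exists [::]; rewrite ?ninv1.
Qed.

Lemma coxlen_subproof g :
  exists k, [exists w : k.-tuple 'I_n.-1, word_perm w == g].
Proof.
have [w gw _] := word_permP g.
by exists (size w); apply/existsP; exists (in_tuple w); apply/eqP.
Qed.
(* The least length of an expression of g in the s_i. *)
Definition coxlen g : nat := ex_minn (coxlen_subproof g).

Lemma coxlenP g : exists w, word_perm w = g /\ size w = coxlen g.
Proof.
rewrite /coxlen; case: ex_minnP => m /existsP [w /eqP gw] _.
by exists w; rewrite size_tuple.
Qed.
Lemma coxlen_le w : (coxlen (word_perm w) <= size w)%N.
Proof.
rewrite /coxlen; case: ex_minnP => m _; apply.
by apply/existsP; exists (in_tuple w).
Qed.

Lemma coxlen_ninv g : coxlen g = ninv g.
Proof.
apply/eqP; rewrite eqn_leq; apply/andP; split.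
  by have [w <- <-] := word_permP g; apply: coxlen_le.
have [w [<- <-]] := coxlenP g; elim: w => [|i w IH] /=; first by rewrite ninv1.
exact: leq_trans (ninv_le_sref _ _) _.
Qed.

Lemma word_perm_cat w w' : word_perm (w ++ w') = word_perm w \oS word_perm w'.
Proof. by elim: w => [|i w IH] /=; rewrite ?mulg1 // IH mulgA. Qed.

Lemma coxlenM g h : (coxlen (g \oS h) <= coxlen g + coxlen h)%N.
Proof.
have [w [<- <-]] := coxlenP g; have [w' [<- <-]] := coxlenP h.
by rewrite -word_perm_cat -size_cat; apply: coxlen_le.
Qed.

Definition DesL g : {set 'I_n.-1} := [set i | (coxlen (sref i \oS g) < coxlen g)%N].

Lemma DesLE g i : (i \in DesL g) = (g^-1%g (hi i) < g^-1%g (lo i))%N.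
Proof.
rewrite inE !coxlen_ninv; case: (ltngtP (g^-1%g (lo i)) (g^-1%g (hi i))) => h.
- by rewrite ninv_sref // ltnNge leqnSn.
- by rewrite (ninv_sref_desc h) ltnSn.
- by have := lo_hi_neq g^-1%g i; rewrite h eqxx.
Qed.

Lemma coxlen_desc g i : i \in DesL g -> coxlen g = (coxlen (sref i \oS g)).+1.
Proof. by rewrite DesLE !coxlen_ninv => /ninv_sref_desc. Qed.
Lemma coxlen_asc g i : i \notin DesL g -> coxlen (sref i \oS g) = (coxlen g).+1.
Proof.
rewrite DesLE !coxlen_ninv => h; apply: ninv_sref.
by have := lo_hi_neq g^-1%g i; move: h; lia.
Qed.

Definition reduced_expr g w := word_perm w = g /\ size w = coxlen g.

Lemma red_word_subproof g :
  exists w : (coxlen g).-tuple 'I_n.-1, word_perm w == g.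
Proof.
have [w [gw sz]] := coxlenP g; move/eqP: sz => sz.
by exists (Tuple sz); apply/eqP.
Qed.
Definition red_word g : seq 'I_n.-1 := xchoose (red_word_subproof g).

Lemma red_wordP g : reduced_expr g (red_word g).
Proof.
split; last by rewrite /red_word size_tuple.
by apply/eqP; apply: (xchooseP (red_word_subproof g)).
Qed.

Lemma coxlen_inv_pos w i g : reduced_expr g (i :: w) ->
  i \in DesL g /\ reduced_expr (sref i \oS g) w.
Proof.
move=> [/= gw sz].
have e : word_perm w = sref i \oS g by rewrite -gw srefKc.
have h : i \in DesL g by rewrite inE -sz -e ltnS coxlen_le.
by split=> //; split=> //; have := coxlen_desc h; rewrite -sz => -[].
Qed.

Lemma reduced_cons w i g : i \in DesL g -> reduced_expr (sref i \oS g) w ->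
  reduced_expr g (i :: w).
Proof.
move=> des [e sz]; split; last by rewrite /= sz (coxlen_desc des).
by rewrite /= e srefKc.
Qed.

Lemma srefEv i (x : 'I_n) : sref i x =
  (if x == i :> nat then i.+1 else if x == i.+1 :> nat then i : nat else x)
  :> nat.
Proof. by rewrite srefE -!val_eqE /=; do ?case: ifP. Qed.

Lemma sref_comm i j : (i.+2 <= j)%N -> (sref i * sref j = sref j * sref i)%g.
Proof.
move=> h; apply/permP => x; rewrite !permM; apply: val_inj => /=.
rewrite !srefEv; by repeat case_if; lia.
Qed.

Lemma sref_braid i j : j = i.+1 :> nat ->
  (sref i * sref j * sref i = sref j * sref i * sref j)%g.
Proof.
move=> h; apply/permP => x; rewrite !permM; apply: val_inj => /=.
rewrite !srefEv; by repeat case_if; lia.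
Qed.

End Symmetric.

Section HeckePi.
Variables (K : fieldType) (n : nat).
Implicit Types (i j : 'I_n.-1) (g : 'S_n) (w : seq 'I_n.-1).

Definition hword w : hecke K n := \prod_(i <- w) hpi K i.

Definition hecke_pi g : hecke K n := hword (red_word g).

Lemma hword_cons i w : hword (i :: w) = hpi K i * hword w.
Proof. exact: big_cons. Qed.

Lemma DesL_comm g i j : (i.+2 <= j)%N -> i \in DesL g -> j \in DesL g ->
  (j \in DesL (sref i \oS g)) /\ (i \in DesL (sref j \oS g)).
Proof.
move=> ij; rewrite !DesLE !sref_invE => h1 h2; split.
  have -> : sref i (hi j) = hi j by apply: ord_inj; rewrite srefEv /=; repeat case_if; lia.
  by have -> : sref i (lo j) = lo j
    by apply: ord_inj; rewrite srefEv /=; repeat case_if; lia.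
have -> : sref j (hi i) = hi i by apply: ord_inj; rewrite srefEv /=; repeat case_if; lia.
by have -> : sref j (lo i) = lo i
  by apply: ord_inj; rewrite srefEv /=; repeat case_if; lia.
Qed.

Lemma DesL_braid g i j : j = i.+1 :> nat -> i \in DesL g -> j \in DesL g ->
  [/\ j \in DesL (sref i \oS g), i \in DesL (sref j \oS (sref i \oS g)),
      i \in DesL (sref j \oS g) & j \in DesL (sref i \oS (sref j \oS g))].
Proof.
move=> ij; rewrite !DesLE !sref_invE.
have hl : hi i = lo j by apply: ord_inj => /=; rewrite ij.
have e1 : sref i (hi j) = hi j by apply: ord_inj; rewrite srefEv /=; repeat case_if; lia.
have e2 : sref j (lo i) = lo i by apply: ord_inj; rewrite srefEv /=; repeat case_if; lia.
have e3 : sref i (lo i) = lo j by rewrite /sref tpermL hl.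
have e4 : sref i (lo j) = lo i by rewrite -hl /sref tpermR.
have e5 : sref j (lo j) = hi j by rewrite /sref tpermL.
have e6 : sref j (hi j) = lo j by rewrite /sref tpermR.
rewrite hl => h1 h2; have h3 := ltn_trans h2 h1.
by split; rewrite !(e1, e2, e3, e4, e5, e6).
Qed.

Lemma hword_reduced g w w' :
  reduced_expr g w -> reduced_expr g w' -> hword w = hword w'.
Proof.
have [m] := ubnP (coxlen g); elim: m g w w' => // m IH g [|i u] [|j v] lt r r'.
- by [].
- by case: r => _ /= z0; case: r' => _; rewrite -z0.
- by case: r' => _ /= z0; case: r => _; rewrite -z0.
have [di ru] := coxlen_inv_pos r; have [dj rv] := coxlen_inv_pos r'.
have IHi x y : reduced_expr (sref i \oS g) x -> reduced_expr (sref i \oS g) y ->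
   hword x = hword y by apply: IH; have := coxlen_desc di; lia.
have IHj x y : reduced_expr (sref j \oS g) x -> reduced_expr (sref j \oS g) y ->
   hword x = hword y by apply: IH; have := coxlen_desc dj; lia.
rewrite !hword_cons.
have comm (a b : 'I_n.-1) : (a.+2 <= b)%N -> a \in DesL g -> b \in DesL g ->
  exists z, reduced_expr (sref a \oS g) (b :: z) /\
            reduced_expr (sref b \oS g) (a :: z).
  move=> ab da db; have [d1 d2] := DesL_comm ab da db.
  have rz := red_wordP (sref b \oS (sref a \oS g)); exists (red_word (sref b \oS (sref a \oS g))).
  have e : sref b \oS (sref a \oS g) = sref a \oS (sref b \oS g).
    by rewrite -!mulgA (sref_comm ab).
  by split; apply: reduced_cons => //; rewrite -e.
have braid (a b : 'I_n.-1) : b = a.+1 :> nat -> a \in DesL g -> b \in DesL g ->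
  exists z, reduced_expr (sref a \oS g) [:: b, a & z] /\
            reduced_expr (sref b \oS g) [:: a, b & z].
  move=> ab da db; have [d1 d2 d3 d4] := DesL_braid ab da db.
  have rz := red_wordP (sref a \oS (sref b \oS (sref a \oS g))).
  exists (red_word (sref a \oS (sref b \oS (sref a \oS g)))).
  have e : sref a \oS (sref b \oS (sref a \oS g)) =
           sref b \oS (sref a \oS (sref b \oS g)).
    by have := sref_braid ab; rewrite -!mulgA => ->.
  split; do 2! [apply: reduced_cons => //].
  by rewrite -e.
case: (ltngtP i j) => [ij|ji|/ord_inj ij].
- case: (ltngtP j i.+1) => ij1; first by lia.
    have [z [r1 r2]] := comm i j ij1 di dj.
    by rewrite (IHi _ _ ru r1) (IHj _ _ rv r2) !hword_cons !mulrA hpi_comm.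
  have [z [r1 r2]] := braid i j ij1 di dj.
  by rewrite (IHi _ _ ru r1) (IHj _ _ rv r2) !hword_cons !mulrA hpi_braid.
- case: (ltngtP i j.+1) => ij1; first by lia.
    have [z [r1 r2]] := comm j i ij1 dj di.
    by rewrite (IHi _ _ ru r2) (IHj _ _ rv r1) !hword_cons !mulrA (hpi_comm _ ij1).
  have [z [r1 r2]] := braid j i ij1 dj di.
  by rewrite (IHi _ _ ru r2) (IHj _ _ rv r1) !hword_cons !mulrA (hpi_braid _ ij1).
- by subst j; rewrite (IHi _ _ ru rv).
Qed.

Lemma hecke_piE g w : reduced_expr g w -> hecke_pi g = hword w.
Proof. exact: hword_reduced (red_wordP g). Qed.

End HeckePi.

(* The pi_i acting on X with a zero added; None is the zero. *)
Record hecke_action (n : nat) (X : Type) := HeckeAction {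
  hact :> 'I_n.-1 -> X -> option X;
  hact_idem : forall i x, obind (hact i) (hact i x) = hact i x;
  hact_braid : forall (i j : 'I_n.-1) x, j = i.+1 :> nat ->
    obind (hact i) (obind (hact j) (hact i x)) =
    obind (hact j) (obind (hact i) (hact j x));
  hact_comm : forall (i j : 'I_n.-1) x, (i.+2 <= j)%N ->
    obind (hact i) (hact j x) = obind (hact j) (hact i x) }.

(* The H_n(0)-module with K-basis X on which the pi_i act by A. *)
Definition hmod (K : fieldType) n (X : finType) (A : hecke_action n X) : Type :=
  {ffun X -> K^o}.

Section HeckeModule.
Variables (K : fieldType) (n : nat) (X : finType) (A : hecke_action n X).

Local Notation hmod := (hmod K A).
HB.instance Definition _ := GRing.Zmodule.on hmod.
Definition hvec (v : hmod) : X -> K := (v : {ffun X -> K^o}).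

Local Notation V := {ffun X -> K^o}.

Definition hbasis (x : X) : hmod := [ffun y => (y == x)%:R].

Definition obasis (o : option X) : V := oapp hbasis 0 o.
Definition hop (i : 'I_n.-1) (v : V) : V := \sum_x v x *: obasis (A i x).

Fixpoint heval (t : hterm K n) : V -> V :=
  match t with
  | HGen i => hop i
  | HScal c => fun v => c *: v
  | HAdd a b => fun v => heval a v + heval b v
  | HMul a b => fun v => heval a (heval b v)
  end.

Lemma heval_linear t : linear (heval t).
Proof.
elim: t => [i|c|a IHa b IHb|a IHa b IHb] k u v /=.
- rewrite /hop scaler_sumr -big_split; apply: eq_bigr => x _ /=.
  by rewrite !ffunE scalerDl scalerA.
- by rewrite scalerDr !scalerA mulrC.
- by rewrite IHa IHb scalerDr addrACA.
- by rewrite IHb IHa.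
Qed.

Lemma basis_sum (v : V) : v = \sum_x v x *: (hbasis x : V).
Proof.
apply/ffunP => y; rewrite sum_ffunE (bigD1 y) //= big1 ?addr0.
  by rewrite !ffunE eqxx [RHS]mulr1.
by move=> x xy; rewrite !ffunE eq_sym (negPf xy) [LHS]mulr0.
Qed.

Lemma lin0 (f : V -> V) : linear f -> f 0 = 0.
Proof.
move=> lf; have := lf 1 0 0; rewrite !scale1r addr0 => /eqP.
by rewrite -subr_eq0 opprD addNKr oppr_eq0 => /eqP.
Qed.

Lemma heval_basis t u : (forall x, heval t (hbasis x) = heval u (hbasis x)) ->
  heval t =1 heval u.
Proof.
move=> tu v; rewrite (basis_sum v).
have [lt lu] := (heval_linear t, heval_linear u).
elim: (index_enum X) => [|x s IH]; first by rewrite big_nil !lin0.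
by rewrite big_cons lt lu IH tu.
Qed.

Lemma hop_obasis i o : hop i (obasis o) = obasis (obind (A i) o).
Proof.
case: o => [x|] /=; last exact: (lin0 (heval_linear (HGen K i))).
rewrite /hop (bigD1 x) //= big1 ?addr0 ?ffunE ?eqxx ?scale1r //.
by move=> y yx; rewrite ffunE (negPf yx) scale0r.
Qed.

Lemma heval_eq t u : heq t u -> heval t =1 heval u.
Proof.
elim=> //=.
- by move=> a b _ ab v; rewrite ab.
- by move=> a b c _ ab _ bc v; rewrite ab.
- by move=> a a' b b' _ ha _ hb v; rewrite ha hb.
- by move=> a a' b b' _ ha _ hb v; rewrite hb ha.
- by move=> a b c v; rewrite addrA.
- by move=> a b v; rewrite addrC.
- by move=> a v; rewrite scale0r add0r.
- by move=> a v; rewrite scaleN1r addNr scale0r.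
- by move=> a v; rewrite scale1r.
- move=> a b c v.
  by have := heval_linear a 1 (heval b v) (heval c v); rewrite !scale1r.
- by move=> x y v; rewrite scalerDl.
- by move=> x y v; rewrite scalerA.
- move=> c a v; have := heval_linear a c v 0.
  by rewrite (lin0 (heval_linear a)) !addr0.
- move=> i; apply: (@heval_basis (HMul (HGen K i) (HGen K i)) (HGen K i)) => x /=.
  by rewrite -[hbasis x]/(obasis (Some x)) !hop_obasis /= hact_idem.
- move=> i j ij; apply: (@heval_basis (HMul (HMul (HGen K i) (HGen K j)) (HGen K i))
    (HMul (HMul (HGen K j) (HGen K i)) (HGen K j))) => x /=.
  by rewrite -[hbasis x]/(obasis (Some x)) !hop_obasis /= hact_braid.
- move=> i j ij; apply: (@heval_basis (HMul (HGen K i) (HGen K j))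
    (HMul (HGen K j) (HGen K i))) => x /=.
  by rewrite -[hbasis x]/(obasis (Some x)) !hop_obasis /= hact_comm.
Qed.

Definition hmod_scale (a : hecke K n) (v : hmod) : hmod := heval (hrep a) v.

Lemma hmod_scaleE t v : hmod_scale (hcl t) v = heval t v.
Proof. exact: heval_eq (hclK t) v. Qed.

Lemma hmod_scaleA a b v :
  hmod_scale a (hmod_scale b v) = hmod_scale (a * b) v.
Proof.
elim/hcl_ind: a => s; elim/hcl_ind: b => t.
by rewrite hclM !hmod_scaleE.
Qed.
Lemma hmod_scale1 : left_id 1 hmod_scale.
Proof. by move=> v; rewrite -hcl1 hmod_scaleE /= [LHS]scale1r. Qed.
Lemma hmod_scaleDr : right_distributive hmod_scale +%R.
Proof.
move=> a u v; have := heval_linear (hrep a) 1 u v.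
by rewrite !scale1r.
Qed.
Lemma hmod_scaleDl v : {morph hmod_scale^~ v : a b / a + b}.
Proof.
elim/hcl_ind=> s; elim/hcl_ind=> t.
by rewrite hclD !hmod_scaleE.
Qed.
HB.instance Definition _ := GRing.Zmodule_isLmodule.Build (hecke K n) hmod
  hmod_scaleA hmod_scale1 hmod_scaleDr hmod_scaleDl.

Lemma hpi_basis i x : hpi K i *: hbasis x = oapp hbasis 0 (A i x).
Proof.
rewrite [LHS]hmod_scaleE /= -[hbasis x]/(obasis (Some x)).
exact: hop_obasis.
Qed.

Lemma hscal_coord (c : K) (v : hmod) x : hvec (c%:A *: v) x = c * hvec v x.
Proof.
have -> : c%:A = hcl (HScal n c) :> hecke K n by exact: mulr1.
by rewrite /hvec [_ *: v]hmod_scaleE /= ffunE.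
Qed.

End HeckeModule.

Section Span.
Variables (K : fieldType) (n : nat) (X : finType) (A : hecke_action n X).

(* E together with 0 is closed under the action. *)
Definition hact_stable (E : {set X}) : Prop :=
  forall i x, x \in E -> oapp (fun y => y \in E) true (A i x).

Variables (E : {set X}) (hE : hact_stable E).

Definition hspan : {pred hmod K A} :=
  [pred v : hmod K A | [forall x, (x \notin E) ==> (hvec v x == 0)]].

Lemma hspanP (v : hmod K A) :
  reflect (forall x, x \notin E -> hvec v x = 0) (v \in hspan).
Proof.
apply: (iffP forallP) => h x; last by apply/implyP => /h ->.
by move=> xE; apply/eqP; move: (h x); rewrite xE.
Qed.

Lemma hspan_spec (v : hmod K A) : v \in hspan <->
  exists c : X -> K, v = \sum_(x in E) (c x)%:A *: hbasis K A x.
Proof.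
split=> [/hspanP h|[c ->]].
  exists (hvec v); apply/ffunP => y; rewrite sum_ffunE.
  have F x : hvec ((hvec v x)%:A *: hbasis K A x) y = hvec v x * (y == x)%:R.
    by have := hscal_coord (hvec v x) (hbasis K A x) y; rewrite /hvec ffunE.
  rewrite (eq_bigr _ (fun x _ => F x)); case: (boolP (y \in E)) => yE.
    rewrite (bigD1 y) //= eqxx mulr1 big1 ?addr0 // => x /andP [_ xy].
    by rewrite eq_sym (negPf xy) mulr0.
  rewrite [LHS]h // big1 // => x xE; case: eqP => [yx|_]; last by rewrite mulr0.
  by rewrite yx xE in yE.
apply/hspanP => y yE; rewrite /hvec sum_ffunE big1 // => x xE.
rewrite -[LHS]/(hvec _ y) hscal_coord /hvec ffunE.
by case: eqP => [yx|_]; rewrite ?mulr0 // yx xE in yE *.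
Qed.

Lemma hspan_heval t (v : hmod K A) : v \in hspan -> (heval A t v : hmod K A) \in hspan.
Proof.
elim: t v => [i|c|a IHa b IHb|a IHa b IHb] v /= hv.
- apply/hspanP => y yE; rewrite /hvec /hop sum_ffunE big1 // => x _.
  rewrite ffunE; case: (boolP (x \in E)) => xE; last first.
    by have /hspanP/(_ x xE) := hv; rewrite /hvec => ->; exact: mul0r.
  have := hE i xE; rewrite /obasis; case: (A i x) => [z|] /= zE; last first.
    by rewrite ffunE scaler0.
  rewrite ffunE; case: eqP => [yz|_]; last exact: mulr0.
  by rewrite yz zE in yE.
- apply/hspanP => y yE; rewrite /hvec ffunE.
  by have /hspanP/(_ y yE) := hv; rewrite /hvec => ->; exact: mulr0.
- apply/hspanP => y yE; rewrite /hvec ffunE.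
  have /hspanP/(_ y yE) := IHa v hv; have /hspanP/(_ y yE) := IHb v hv.
  by rewrite /hvec => -> ->; rewrite addr0.
- by apply: IHa; apply: IHb.
Qed.

Lemma hspan_submod : submod_closed hspan.
Proof.
split; first by apply/hspanP => x _; rewrite /hvec ffunE.
move=> a u v hu hv; apply/hspanP => y yE; rewrite /hvec ffunE.
have hau : a *: u \in hspan by apply: hspan_heval.
have /hspanP/(_ y yE) := hau; have /hspanP/(_ y yE) := hv.
by rewrite /hvec => -> ->; rewrite addr0.
Qed.

End Span.

(* hE is a phantom argument, from which the submodule structure is inferred. *)
Definition hspan_pred (K : fieldType) n (X : finType)
  (A : hecke_action n X) (E : {set X}) (_ : hact_stable A E) :
  {pred hmod K A} := hspan (K := K) (A := A) E.

HB.instance Definition _ (K : fieldType) n (X : finType)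
  (A : hecke_action n X) (E : {set X}) (hE : hact_stable A E) :=
  GRing.isSubmodClosed.Build (hecke K n) (hmod K A) (hspan_pred (K := K) hE)
    (hspan_submod K hE).

Record hsubmod (K : fieldType) n (X : finType)
  (A : hecke_action n X) (E : {set X}) (hE : hact_stable A E) : Type :=
  HSubmod { hsubmod_val : hmod K A; hsubmod_in : hsubmod_val \in hspan_pred (K := K) hE }.

HB.instance Definition _ (K : fieldType) n (X : finType)
  (A : hecke_action n X) (E : {set X}) (hE : hact_stable A E) :=
  [isSub for @hsubmod_val K n X A E hE].
HB.instance Definition _ (K : fieldType) n (X : finType)
  (A : hecke_action n X) (E : {set X}) (hE : hact_stable A E) :=
  [Choice of hsubmod K hE by <:].
HB.instance Definition _ (K : fieldType) n (X : finType)
  (A : hecke_action n X) (E : {set X}) (hE : hact_stable A E) :=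
  [SubChoice_isSubLmodule of hsubmod K hE by <:].

(* Placements x : 'I_n -> T of 1, ..., n at positions in columns c; pi_i looks
   at the positions of i and i+1. *)
Section Placement.
Variables (n : nat) (T : Type) (c : T -> nat) (zr : rel T).
Hypothesis zr_same : forall p q, c p = c q -> zr p q.
Hypothesis zr_near : forall p q, zr p q -> (c q <= (c p).+1)%N.
Implicit Types (x : {ffun 'I_n -> T}) (i j : 'I_n.-1).

Definition psw i x : {ffun 'I_n -> T} := [ffun v => x (sref i v)].
Definition pact i x : option {ffun 'I_n -> T} :=
  if (c (x (hi i)) < c (x (lo i)))%N then Some x
  else if zr (x (lo i)) (x (hi i)) then None else Some (psw i x).

Lemma psw_lo i x : psw i x (lo i) = x (hi i).
Proof. by rewrite ffunE /sref tpermL. Qed.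
Lemma psw_hi i x : psw i x (hi i) = x (lo i).
Proof. by rewrite ffunE /sref tpermR. Qed.

Lemma pact_idem i x : obind (pact i) (pact i x) = pact i x.
Proof.
rewrite {2 3}/pact; case: ifP => h1 /=; first by rewrite /pact h1.
case: ifP => h2 //=; rewrite /pact psw_lo psw_hi.
case: ifP => // h3; move: (zr_same (p := x (lo i)) (q := x (hi i))).
by rewrite h2; lia.
Qed.

Lemma zrF (p q : T) : [&& (c p == c q) ==> zr p q & zr p q ==> (c q <= (c p).+1)%N].
Proof.
apply/andP; split; apply/implyP; [move/eqP; exact: zr_same | exact: zr_near].
Qed.

Lemma pact_comm i j x : (i.+2 <= j)%N ->
  obind (pact i) (pact j x) = obind (pact j) (pact i x).
Proof.
move=> ij.
have e1 y : psw i y (lo j) = y (lo j).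
  by rewrite ffunE; congr (y _); apply: ord_inj; rewrite srefEv /=; repeat case_if; lia.
have e2 y : psw i y (hi j) = y (hi j).
  by rewrite ffunE; congr (y _); apply: ord_inj; rewrite srefEv /=; repeat case_if; lia.
have e3 y : psw j y (lo i) = y (lo i).
  by rewrite ffunE; congr (y _); apply: ord_inj; rewrite srefEv /=; repeat case_if; lia.
have e4 y : psw j y (hi i) = y (hi i).
  by rewrite ffunE; congr (y _); apply: ord_inj; rewrite srefEv /=; repeat case_if; lia.
have e5 : psw i (psw j x) = psw j (psw i x).
  apply/ffunP => v; rewrite !ffunE; congr (x _).
  by rewrite -!permM (sref_comm ij).
rewrite /pact; do 4! [case: ifP => ? //=; rewrite ?(e1, e2, e3, e4)];
  rewrite ?e5; do ?[case: ifP => ? //=; rewrite ?(e1, e2, e3, e4)]; congruence.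
Qed.

Lemma pact_braid i j x : j = i.+1 :> nat ->
  obind (pact i) (obind (pact j) (pact i x)) =
  obind (pact j) (obind (pact i) (pact j x)).
Proof.
move=> ij.
have hl : lo j = hi i by apply: ord_inj => /=; rewrite ij.
have e1 y : psw i y (hi j) = y (hi j).
  by rewrite ffunE; congr (y _); apply: ord_inj; rewrite srefEv /=; repeat case_if; lia.
have e2 y : psw j y (lo i) = y (lo i).
  by rewrite ffunE; congr (y _); apply: ord_inj; rewrite srefEv /=; repeat case_if; lia.
have e3 y : psw j y (hi i) = y (hi j) by rewrite -hl psw_lo.
have e4 y : psw j y (hi j) = y (hi i) by rewrite -hl psw_hi.
have e5 : psw i (psw j (psw i x)) = psw j (psw i (psw j x)).
  apply/ffunP => v; rewrite !ffunE; congr (x _).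
  by rewrite -!permM !mulgA (sref_braid ij).
have E := (e1, e2, e3, e4, psw_lo, psw_hi).
have := (zrF (x (lo i)) (x (hi i)), zrF (x (lo i)) (x (hi j)), zrF (x (hi i)) (x (hi j))).
rewrite /pact hl.
repeat (case: ifP => ? //=; rewrite ?E); rewrite ?e5 //.
all: move=> [[/andP[? ?] /andP[? ?]] /andP[? ?]]; lia.
Qed.

Section Transfer.
Variables (X : Type) (emb : X -> {ffun 'I_n -> T}) (a : 'I_n.-1 -> X -> option X).
Hypotheses (emb_inj : injective emb).
Hypothesis aE : forall i z, omap emb (a i z) = pact i (emb z).

Lemma omap_emb_inj : injective (omap emb).
Proof. by move=> [x|] [y|] //= [/emb_inj ->]. Qed.
Lemma omap_embE i o : omap emb (obind (a i) o) = obind (pact i) (omap emb o).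
Proof. by case: o => //= z; rewrite aE. Qed.

Lemma transfer_idem i z : obind (a i) (a i z) = a i z.
Proof. by apply: omap_emb_inj; rewrite !(omap_embE, aE) pact_idem. Qed.
Lemma transfer_braid i j z : j = i.+1 :> nat ->
  obind (a i) (obind (a j) (a i z)) = obind (a j) (obind (a i) (a j z)).
Proof.
by move=> ij; apply: omap_emb_inj; rewrite !(omap_embE, aE) pact_braid.
Qed.
Lemma transfer_comm i j z : (i.+2 <= j)%N ->
  obind (a i) (a j z) = obind (a j) (a i z).
Proof.
by move=> ij; apply: omap_emb_inj; rewrite !(omap_embE, aE) pact_comm.
Qed.
End Transfer.
End Placement.

Section WeakOrder.
Variable n : nat.
Implicit Types (i j : 'I_n.-1) (g xi rho : 'S_n).

Definition leL xi rho : bool :=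
  [exists g : 'S_n, (rho == g \oS xi) && (coxlen rho == coxlen g + coxlen xi)%N].

Lemma leL_trans g xi rho : leL xi g -> leL g rho -> leL xi rho.
Proof.
move=> /existsP [a /andP [/eqP e1 /eqP l1]] /existsP [b /andP [/eqP e2 /eqP l2]].
have e : rho = (b \oS a) \oS xi by rewrite e2 e1 mulgA.
apply/existsP; exists (b \oS a); rewrite {1}e eqxx /= eqn_leq.
have := coxlenM (b \oS a) xi; have := coxlenM b a; rewrite -e => h1 h2; rewrite h2 /=.
by rewrite l2 l1 addnA leq_add2r.
Qed.

Definition desact i g : 'S_n := if i \in DesL g then g else sref i \oS g.

Lemma leL_desact i g : leL g (desact i g).
Proof.
rewrite /desact; case: ifP => [_|/negbT asc]; apply/existsP.
  exists 1%g; rewrite mulg1 eqxx /= coxlen_ninv.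
  by have -> : coxlen (1%g : 'S_n) = 0%N; rewrite ?coxlen_ninv ?ninv1.
exists (sref i); rewrite eqxx (coxlen_asc asc) /=.
have := coxlen_le [:: i]; rewrite /= mul1g.
by have := coxlenM (sref i) g; rewrite (coxlen_asc asc); lia.
Qed.

Lemma desactE i g :
  omap (fun g : 'S_n => [ffun v => g^-1%g v]) (Some (desact i g)) =
  pact (fun p : 'I_n => p : nat) (fun p q => p == q) i [ffun v => g^-1%g v].
Proof.
rewrite /pact !ffunE /desact DesLE; case: ifP => //= _.
rewrite (inj_eq perm_inj) (negPf (lo_neq_hi i)); congr Some.
by apply/ffunP => v; rewrite !ffunE sref_invE.
Qed.

Lemma inv_ffun_inj : injective (fun g : 'S_n => [ffun v => g^-1%g v]).
Proof.
move=> g h /ffunP e; apply: invg_inj; apply/permP => v.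
by have := e v; rewrite !ffunE.
Qed.

Let zs (p q : 'I_n) : p = q :> nat -> p == q.
Proof. by move/ord_inj->. Qed.
Let zn (p q : 'I_n) : p == q -> (q <= p.+1)%N.
Proof. by move/eqP->. Qed.

Lemma desact_idem i g : desact i (desact i g) = desact i g.
Proof. by have [] := transfer_idem zs inv_ffun_inj desactE i g. Qed.
Lemma desact_braid i j g : j = i.+1 :> nat ->
  desact i (desact j (desact i g)) = desact j (desact i (desact j g)).
Proof.
by move=> ij; have [] := transfer_braid zs zn inv_ffun_inj desactE g ij.
Qed.
Lemma desact_comm i j g : (i.+2 <= j)%N ->
  desact i (desact j g) = desact j (desact i g).
Proof. by move=> ij; have [] := transfer_comm inv_ffun_inj desactE g ij. Qed.

End WeakOrder.

Section Interval.
Variables (n : nat) (xi rho : 'S_n).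

Definition intervalL : Type := {g : 'S_n | leL xi g && leL g rho}.
HB.instance Definition _ := Finite.on intervalL.

(* insub g is None when g is outside the interval. *)
Definition bact (i : 'I_n.-1) (g : intervalL) : option intervalL :=
  if i \in DesL (val g) then Some g else insub (sref i \oS val g).

Lemma bactE i g : bact i g = insub (desact i (val g)).
Proof. by rewrite /bact /desact; case: ifP => // _; rewrite valK. Qed.

Lemma bact_insub i (g : 'S_n) : leL xi g ->
  obind (bact i) (insub g) = insub (desact i g).
Proof.
move=> xg; case: insubP => [x _ <- /=|]; first exact: bactE.
rewrite xg /= => gr; rewrite insubF //; apply/negbTE; rewrite negb_and.
by apply/orP; right; apply: contra gr; apply: leL_trans (leL_desact i g).
Qed.

Lemma interval_ge (g : intervalL) : leL xi (val g).
Proof. by case/andP: (valP g). Qed.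
Lemma leL_desact2 i g : leL xi g -> leL xi (desact i g).
Proof. by move/leL_trans; apply; apply: leL_desact. Qed.

Lemma bact_idem i g : obind (bact i) (bact i g) = bact i g.
Proof.
rewrite !bactE bact_insub ?desact_idem //.
exact: leL_desact2 (interval_ge g).
Qed.
Lemma bact_braid (i j : 'I_n.-1) g : j = i.+1 :> nat ->
  obind (bact i) (obind (bact j) (bact i g)) =
  obind (bact j) (obind (bact i) (bact j g)).
Proof.
move=> ij; have xg := interval_ge g.
have xi1 := leL_desact2 i xg; have xj1 := leL_desact2 j xg.
have xi2 := leL_desact2 j xi1; have xj2 := leL_desact2 i xj1.
rewrite !bactE (bact_insub j xi1) (bact_insub i xi2) (bact_insub i xj1).
by rewrite (bact_insub j xj2) (desact_braid _ ij).
Qed.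
Lemma bact_comm (i j : 'I_n.-1) g : (i.+2 <= j)%N ->
  obind (bact i) (bact j g) = obind (bact j) (bact i g).
Proof.
move=> ij; have xg := interval_ge g.
have xi1 := leL_desact2 i xg; have xj1 := leL_desact2 j xg.
by rewrite !bactE (bact_insub j xi1) (bact_insub i xj1) (desact_comm _ ij).
Qed.

Definition weak_bruhat_action : hecke_action n intervalL :=
  HeckeAction bact_idem bact_braid bact_comm.

End Interval.

Definition Bmod (K : fieldType) n (xi rho : 'S_n) :=
  hmod K (weak_bruhat_action xi rho).

Record composition (n : nat) := Composition {
  cparts :> seq nat;
  cparts_gt0 : all (leq 1) cparts;
  cparts_sum : sumn cparts = n }.

(* One-line notation of the standardization of w, with 0-based values. *)
Definition standardization (w : seq nat) : seq nat :=
  [seq count (fun j => (nth 0 w j < nth 0 w i) ||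
                       (nth 0 w j == nth 0 w i) && (j < i))%N
             (iota 0 (size w)) | i <- iota 0 (size w)].

(* Boxes (row, column), 0-based. *)
Definition box (alpha : seq nat) : Type :=
  {r : 'I_(size alpha) & 'I_(nth 0%N alpha r)}.
HB.instance Definition _ alpha := Finite.on (box alpha).
Definition brow alpha (b : box alpha) : nat := tag b.
Definition bcol alpha (b : box alpha) : nat := tagged b.

Section SPCT.
Variables (n : nat) (alpha : composition n) (sigma : 'S_(size alpha)).
Implicit Types (b c d : box alpha) (i : 'I_n.-1).

(* The entry k of a tableau is the element k - 1 of 'I_n. *)
Local Notation filling := {ffun box alpha -> 'I_n}.

Definition first_column (t : filling) : seq nat :=
  [seq (t b : nat) | b <- sort (fun b c => brow b <= brow c)%N
                            (enum [pred b : box alpha | bcol b == 0%N])].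

Definition spct_type (t : filling) : bool :=
  standardization (first_column t) ==
  [seq (sigma r : nat) | r <- enum 'I_(size alpha)].

Definition spct_rows (t : filling) : bool :=
  [forall b, forall c, (brow b == brow c) && (bcol b < bcol c)%N ==>
     (t c < t b)%N].

Definition spct_triple (t : filling) : bool :=
  [forall b, forall c,
    [&& (brow b < brow c)%N, bcol c == (bcol b).+1 & (t c < t b)%N] ==>
    [exists d, [&& brow d == brow b, bcol d == (bcol b).+1 & (t c < t d)%N]]].

Definition is_spct (t : filling) : bool :=
  [&& injectiveb t, spct_type t, spct_rows t & spct_triple t].

Definition spct : Type := {t : filling | is_spct t}.
HB.instance Definition _ := Finite.on spct.
Implicit Types (t u : spct).

Definition entry t b : 'I_n := val t b.

Lemma entry_inj t : injective (entry t).
Proof. by case/and4P: (valP t) => /injectiveP. Qed.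

Lemma card_box : #|{: box alpha}| = n.
Proof.
rewrite /box card_tagged -[RHS](cparts_sum alpha); congr sumn.
apply: (@eq_from_nth _ 0%N); first by rewrite size_map -cardE card_ord.
move=> k; rewrite size_map -cardE card_ord => kn.
have k0 : 'I_(size alpha) by exact: Ordinal kn.
rewrite (nth_map (Ordinal kn)) ?size_enum_ord // card_ord; congr nth.
by rewrite nth_enum_ord.
Qed.

Lemma entry_onto t (v : 'I_n) : v \in codom (entry t).
Proof. by apply: inj_card_onto (@entry_inj t) _ v; rewrite card_ord card_box. Qed.

Definition bpos t (v : 'I_n) : box alpha := iinv (entry_onto t v).

Lemma bposK t v : entry t (bpos t v) = v.
Proof. exact: f_iinv. Qed.
Lemma entryK t b : bpos t (entry t b) = b.
Proof. by apply: (@entry_inj t); rewrite bposK. Qed.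

Definition attacking t i : bool :=
  let p := bpos t (lo i) in let q := bpos t (hi i) in
  (bcol p == bcol q) || (bcol q == (bcol p).+1) && (brow p < brow q)%N.

Definition swap_filling t i : filling :=
  [ffun b => sref i (entry t b)].

(* insub never yields None here, by spct_swap below. *)
Definition sact i t : option spct :=
  if (bcol (bpos t (hi i)) < bcol (bpos t (lo i)))%N then Some t
  else if attacking t i then None
  else insub (swap_filling t i).

Lemma swap_same_col t i b c : ~~ attacking t i -> bcol b = bcol c ->
  (swap_filling t i b < swap_filling t i c)%N = (entry t b < entry t c)%N.
Proof.
rewrite /attacking negb_or => /andP [natt _] bc; rewrite !ffunE.
have ne b' c' : bcol b' = bcol c' -> (entry t b', entry t c') != (lo i, hi i).
  move=> e; apply: contra natt => /eqP [<- <-]; rewrite !entryK.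
  exact/eqP.
apply/idP/idP => [h|]; last exact/sref_lt/ne.
rewrite -(sref_involutive i (entry t b)) -(sref_involutive i (entry t c)).
apply: sref_lt h; apply/eqP => -[e1 e2].
have e3 : entry t b = hi i by rewrite -(sref_involutive i (entry t b)) e1 /sref tpermL.
have e4 : entry t c = lo i by rewrite -(sref_involutive i (entry t c)) e2 /sref tpermR.
by have := ne c b (esym bc); rewrite e3 e4 eqxx.
Qed.

Lemma standardization_eq (w w' : seq nat) : size w = size w' ->
  (forall x y, (x < size w)%N -> (y < size w)%N ->
     (nth 0 w x < nth 0 w y)%N = (nth 0 w' x < nth 0 w' y)%N) ->
  standardization w = standardization w'.
Proof.
move=> sz h; rewrite /standardization -sz; apply/eq_in_map => x.
rewrite mem_iota /= => hx; apply: eq_in_count => y; rewrite mem_iota /= => hy.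
have := h x y hx hy; have := h y x hy hx.
case: (ltngtP (nth 0%N w y) (nth 0%N w x)); 
  by case: (ltngtP (nth 0%N w' y) (nth 0%N w' x)).
Qed.

Lemma spct_swap t i : ~~ attacking t i ->
  (bcol (bpos t (lo i)) <= bcol (bpos t (hi i)))%N -> is_spct (swap_filling t i).
Proof.
move=> natt weak; have /and4P [_ ty /'forall_forallP rows /'forall_forallP tri] := valP t.
apply/and4P; split.
- apply/injectiveP => b c; rewrite !ffunE => /(inv_inj (sref_involutive i)).
  exact: entry_inj.
- move: ty; rewrite /spct_type => /eqP <-; apply/eqP/standardization_eq.
    by rewrite !size_map.
  rewrite /first_column; set s := sort _ _ => x y.
  rewrite size_map => hx hy.
  have b0 : box alpha by move: hx; case: (s) => [//|b0 _ _].
  rewrite !(nth_map b0) //.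
  have col0 k : (k < size s)%N -> bcol (nth b0 s k) = 0%N.
    by move=> /(mem_nth b0); rewrite mem_sort mem_enum => /eqP.
  by apply: swap_same_col; rewrite ?col0.
- apply/'forall_forallP => b c; apply/implyP => bc.
  have := rows b c; rewrite bc /= !ffunE => h; apply: sref_lt h.
  apply/eqP => -[e1 e2]; case/andP: bc => _; rewrite ltnNge.
  by rewrite -(entryK t b) -(entryK t c) /entry e1 e2 weak.
- apply/'forall_forallP => b c; apply/implyP => /and3P [rbc cbc h].
  have h' : (entry t c < entry t b)%N.
    move: h; rewrite !ffunE => h.
    rewrite -(sref_involutive i (entry t b)) -(sref_involutive i (entry t c)).
    apply: sref_lt h; apply/eqP => -[e1 e2].
    have e3 : entry t c = hi i
      by rewrite -(sref_involutive i (entry t c)) e1 /sref tpermL.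
    have e4 : entry t b = lo i
      by rewrite -(sref_involutive i (entry t b)) e2 /sref tpermR.
    by move: natt; rewrite /attacking -e3 -e4 !entryK cbc rbc orbT.
  have := tri b c; rewrite rbc cbc /= h' /= => /existsP [d /and3P [rd cd hd]].
  apply/existsP; exists d; rewrite rd cd /= swap_same_col //.
  by rewrite (eqP cd) (eqP cbc).
Qed.

Lemma sact_swap t i : ~~ attacking t i ->
  (bcol (bpos t (lo i)) <= bcol (bpos t (hi i)))%N ->
  exists2 u, sact i t = Some u & val u = swap_filling t i.
Proof.
move=> natt weak; have sp := spct_swap natt weak.
exists (Sub (swap_filling t i) sp); last by rewrite SubK.
by rewrite /sact ltnNge weak /= (negPf natt) insubT.
Qed.

Definition box_attack b c : bool :=
  (bcol b == bcol c) || (bcol c == (bcol b).+1) && (brow b < brow c)%N.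

Definition placement t : {ffun 'I_n -> box alpha} := [ffun v => bpos t v].

Lemma placement_inj : injective placement.
Proof.
move=> t u /ffunP e; apply: val_inj; apply/ffunP => b.
have := e (entry t b); rewrite !ffunE entryK => eb.
by rewrite [in RHS]eb -/(entry u _) bposK.
Qed.

Lemma sactE i t :
  omap placement (sact i t) = pact (@bcol alpha) box_attack i (placement t).
Proof.
rewrite /pact !ffunE; case: ifP => h1; first by rewrite /sact h1.
have -> : box_attack (bpos t (lo i)) (bpos t (hi i)) = attacking t i by [].
case: ifP => h2; first by rewrite /sact h1 h2.
have weak : (bcol (bpos t (lo i)) <= bcol (bpos t (hi i)))%N by rewrite leqNgt h1.
have [u -> eu] := sact_swap (negbT h2) weak; rewrite /=.
congr Some; apply/ffunP => v; rewrite !ffunE; apply: (@entry_inj u).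
by rewrite bposK /entry eu ffunE bposK sref_involutive.
Qed.

Let zs b c : bcol b = bcol c -> box_attack b c.
Proof. by move=> e; rewrite /box_attack e eqxx. Qed.
Let zn b c : box_attack b c -> (bcol c <= (bcol b).+1)%N.
Proof. by case/orP => [/eqP->|/andP[/eqP->]]. Qed.

Definition spct_action : hecke_action n spct := HeckeAction
  (transfer_idem zs placement_inj sactE)
  (fun i j x => transfer_braid zs zn placement_inj sactE x)
  (fun i j x => transfer_comm placement_inj sactE x).

Definition spct_sim t u : bool :=
  [forall b, forall c, (bcol b == bcol c) ==>
     ((entry t b < entry t c)%N == (entry u b < entry u c)%N)].

Definition spct_classes : {set {set spct}} :=
  equivalence_partition spct_sim [set: spct].

Lemma spct_simP t u : reflect
  (forall b c, bcol b = bcol c ->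
     (entry t b < entry t c)%N = (entry u b < entry u c)%N) (spct_sim t u).
Proof.
apply: (iffP 'forall_forallP) => h b c; first by move=> e; have := h b c; rewrite e eqxx => /eqP.
by apply/implyP => /eqP /h ->.
Qed.

Lemma sact_sim i t u : sact i t = Some u -> spct_sim t u.
Proof.
rewrite /sact; case: ifP => [_ [->]|_]; first exact/spct_simP.
case: ifP => // /negbT natt; case: insubP => // u' _ e [<-].
by apply/spct_simP => b c bc; rewrite [entry u' b]/entry [entry u' c]/entry e swap_same_col.
Qed.

Lemma class_stable E : E \in spct_classes -> hact_stable spct_action E.
Proof.
case/imsetP => x _ -> i t; rewrite !inE => /spct_simP xt.
case e: (spct_action i t) => [u|] //=; rewrite !inE.
have /spct_simP tu := sact_sim e.
by apply/spct_simP => b c bc; rewrite xt // tu.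
Qed.

Section Source.
Variable K : fieldType.
Implicit Types E : {set spct}.

Definition Smod := hmod K spct_action.

(* The submodule of Smod spanned by E. *)
Definition Smod_class E (hE : E \in spct_classes) := hsubmod K (class_stable hE).

Definition is_source E t : Prop :=
  t \in E /\ forall u, u \in E -> exists g : 'S_n,
    hecke_pi K g *: hbasis K spct_action t = hbasis K spct_action u.

Definition is_sink E t : Prop :=
  t \in E /\ forall u, u \in E -> exists g : 'S_n,
    hecke_pi K g *: hbasis K spct_action u = hbasis K spct_action t.

End Source.

(* The sequence d_0, d_1, ..., d_{p+1}; the letter i : 'I_n.-1 is the 1-based
   index i.+1. *)
Definition breaks t : seq nat :=
  0%N :: rcons [seq (nat_of_ord i).+1 | i <- enum 'I_n.-1 &
                 (bcol (bpos t (lo i)) <= bcol (bpos t (hi i)))%N] n.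

(* H_j, for 1 <= j <= p + 1 *)
Definition strip t (j : nat) : {set box alpha} :=
  [set b | (nth 0 (breaks t) j.-1 < (entry t b).+1)%N &&
           ((entry t b).+1 <= nth 0 (breaks t) j)%N].

Definition strip_boxes t (j : nat) : seq (box alpha) :=
  sort (fun b c => bcol b <= bcol c)%N (enum (strip t j)).

(* tE determines the strips; the entries read are those of t. *)
Definition reading_word tE t : seq 'I_n :=
  flatten [seq [seq entry t b | b <- strip_boxes tE j]
              | j <- iota 1 (size (breaks tE)).-1].

Definition reading_boxes tE : seq (box alpha) :=
  flatten [seq strip_boxes tE j | j <- iota 1 (size (breaks tE)).-1].

Lemma reading_wordE tE t : reading_word tE t = map (entry t) (reading_boxes tE).
Proof. by rewrite /reading_word /reading_boxes map_flatten -map_comp. Qed.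

Lemma breaks_sorted t : sorted leq (breaks t).
Proof.
rewrite /breaks; set s := [seq _ | _ <- _ & _].
have ss : sorted leq s.
  rewrite /s sorted_map; apply: sorted_filter; first by move=> x y z /= h1 h2; lia.
  rewrite -(@sorted_map _ _ val (fun x y => x < y.+1)%N) val_enum_ord.
  by apply: sub_sorted (iota_ltn_sorted 0 _) => x y /= h; lia.
have sn : all (leq^~ n) s.
  by apply/allP => x /mapP [i _ ->]; have := ltn_ord i; lia.
rewrite /= rcons_path; apply/andP; split; first by case: (s) ss => //=.
by case/lastP: (s) sn => //= s' x; rewrite last_rcons all_rcons => /andP [].
Qed.

Lemma reading_boxes_perm t : perm_eq (reading_boxes t) (enum {: box alpha}).
Proof.
apply/allP => b _ /=; rewrite count_flatten -map_comp.
rewrite [X in _ == X]count_uniq_mem ?enum_uniq // mem_enum.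
set d := nth 0%N (breaks t); set v := (entry t b).+1.
have cE j : (count_mem b \o strip_boxes t) j = (d j.-1 < v <= d j)%N :> nat.
  by rewrite /= count_sort count_uniq_mem ?enum_uniq // mem_enum inE.
rewrite (eq_map cE).
have mono j : (j.+1 < size (breaks t))%N -> (d j <= d j.+1)%N.
  by move=> hj; apply: (sorted_leq_nth leq_trans leqnn) (breaks_sorted t) _ _ _ _ _; rewrite ?inE; lia.
have main m : (m < size (breaks t))%N ->
    (sumn [seq ((d j.-1 < v <= d j)%N : nat) | j <- iota 1 m] = (v <= d m))%N.
  elim: m => [|m IH] hm; first by rewrite /d /= /v.
  rewrite -[in iota 1 _](addn1 m) iotaD map_cat sumn_cat IH; last by lia.
  by have := mono m hm; rewrite add1n /= addn0; case: (leqP v (d m)) => /=; lia.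
rewrite main; last by rewrite /breaks /=; lia.
rewrite /d nth_last /breaks /= last_rcons.
by have := ltn_ord (entry t b); rewrite -/v => ->.
Qed.

Lemma size_reading_word tE t : size (reading_word tE t) = n.
Proof.
by rewrite reading_wordE size_map (perm_size (reading_boxes_perm tE)) -cardE card_box.
Qed.
Lemma uniq_reading_word tE t : uniq (reading_word tE t).
Proof.
rewrite reading_wordE map_inj_uniq; last exact: entry_inj.
by rewrite (perm_uniq (reading_boxes_perm tE)) enum_uniq.
Qed.

Lemma reading_perm_subproof tE t :
  injective (fun k : 'I_n => nth k (reading_word tE t) k).
Proof.
move=> k l /eqP; rewrite (set_nth_default k l) ?size_reading_word //.
by rewrite nth_uniq ?size_reading_word ?uniq_reading_word // => /eqP /ord_inj.
Qed.

(* The permutation whose one-line notation is the reading word. *)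
Definition reading_perm tE t : 'S_n := perm (@reading_perm_subproof tE t).

Lemma reading_permE tE t :
  [seq reading_perm tE t k | k <- enum 'I_n] = reading_word tE t.
Proof.
have sz : size [seq reading_perm tE t k | k <- enum 'I_n] = n.
  by rewrite size_map size_enum_ord.
have sw := size_reading_word tE t.
case: (posnP n) => n0; first by rewrite [LHS]size0nil ?[RHS]size0nil ?sz ?sw.
pose x0 := Ordinal n0; apply: (@eq_from_nth _ x0); rewrite sz ?sw // => k kn.
rewrite (nth_map x0) ?size_enum_ord // permE.
have -> : nth x0 (enum 'I_n) k = Ordinal kn by apply: ord_inj; rewrite nth_enum_ord.
by apply: set_nth_default; rewrite sw.
Qed.

End SPCT.

(* Main.v *)
From HB Require Import structures.
Require Import Defs.
From mathcomp Require Import all_boot all_order all_fingroup all_algebra.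
From mathcomp Require Import reals.
From mathcomp.real_closed Require Import complex.
From mathcomp Require Import zify.

(** Reading the boxes of a tableau t of E in the order fixed by the source tE
    gives a permutation read t, and read is injective because the order does
    not depend on t.  The isomorphism matches the basis vector t with read t;
    three facts make this work.

    First, read sends the descents of t to the left descents of read t: i + 1
    is strictly left of i in t if and only if its box is read before that of i
    ([DesL_reading]).  One direction is an invariant of the action: of two boxes,
    if the one read earlier holds the larger entry, it lies strictly further left
    ([inversion_col]); this holds in tE by the definition of the strips, and the
    action only ever moves a larger entry to the left.  For the other direction,
    let i + 1 be strictly left of i in t.  If the two boxes are not in one row,
    exchanging i and i + 1 yields a tableau of E again ([unswap]), and the
    invariant for that tableau gives the claim.  If they are in one row, they are
    neighbours, and the point is that they are already consecutive in tE
    ([source_row_consecutive]), hence in one strip.  Here it matters that tE is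
    the source: if i + 1 is strictly left of i in tE, it lies in the column
    immediately to the left, since otherwise [unswap] gives a tableau of E which
    cannot be reached from tE ([source_descent]).

    Second, the action on t therefore corresponds to multiplying read t by s_i
    on the left whenever it is a swap, so read t lies between read tE and
    read tE' in left weak order ([leL_source], [leL_sink]).

    Third, if i and i + 1 attack each other in t, then the relative order of the
    entries of their two boxes is the same in all of E ([box_attack_mono]).
    Left weak order preserves inversions of positions ([leL_inversion]), so
    s_i read t is not below read tE' ([attacking_leL]).  This makes the zeros of
    the two actions agree, and climbing from read tE shows that every element of
    the interval is the reading of a tableau of E ([interval_reading]). *)

Set Implicit Arguments.
Unset Strict Implicit.
Unset Printing Implicit Defensive.

Import GRing.Theory.
Local Open Scope ring_scope.
Local Open Scope complex_scope.

(** * Modules with a basis permuted up to zero *)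

(** Acting by a product of generators on a basis vector follows a path of basis
    vectors until it possibly drops to zero; ending at a basis vector excludes
    the drop.  This turns the linear definition of source and sink into an
    induction principle. *)
Lemma hecke_pi_ind (K : fieldType) n (X : finType) (A : hecke_action n X)
    (P : X -> Prop) (g : 'S_n) (x y : X) :
    (forall i t u, A i t = Some u -> P t -> P u) ->
  hecke_pi K g *: hbasis K A x = hbasis K A y -> P x -> P y.
Proof.
move=> step e Px; move: e; rewrite /hecke_pi.
have [o -> Po] : exists2 o : option X,
    hword K (red_word g) *: hbasis K A x = oapp (hbasis K A) 0 o &
    forall z, o = Some z -> P z.
  elim: (red_word g) => [|i w [o IHo Po]].
    by exists (Some x); [rewrite /hword big_nil scale1r | move=> z [<-]].
  exists (obind (A i) o); last first.
    by case: o Po {IHo} => //= z Po u /step; apply; apply: Po.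
  rewrite hword_cons -scalerA IHo; case: o {IHo Po} => [z|] /=.
    exact: hpi_basis.
  exact: scaler0.
case: o Po => [z|] Po /= /ffunP /(_ y); rewrite !ffunE eqxx.
  case: eqP => [->|_ /esym /eqP]; first by move=> _; apply: Po.
  by rewrite oner_eq0.
by move/esym/eqP; rewrite oner_eq0.
Qed.

(** The map from the submodule to the other module is restriction of coordinates
    along phi; it commutes with all of the algebra because, by induction on
    terms, it commutes with the generators. *)
Lemma hsubmod_iso (K : fieldType) n (X Y : finType) (A : hecke_action n X)
    (B : hecke_action n Y) (E : {set X}) (hE : hact_stable A E) (phi : Y -> X) :
    injective phi -> codom phi =i E ->
    (forall i y, A i (phi y) = omap phi (B i y)) ->
  exists f : {linear hsubmod K hE -> hmod K B}, bijective f.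
Proof.
move=> phi_inj phiE phiA.
have phi_in y : phi y \in E by rewrite -phiE codom_f.
pose pull (v : hmod K A) : hmod K B := [ffun y => hvec v (phi y)].
have pull_heval t (v : hmod K A) : v \in hspan E ->
    pull (heval A t v) = heval B t (pull v).
  elim: t v => [i|c|a IHa b IHb|a IHa b IHb] v vE /=.
  - apply/ffunP => y; rewrite ffunE /hvec /hop !sum_ffunE.
    have -> : \sum_x (v x *: obasis K A (A i x)) (phi y) =
              \sum_(x in E) (v x *: obasis K A (A i x)) (phi y) :> K.
      rewrite [RHS]big_mkcond; apply: eq_bigr => x _; case: ifP => // /negbT xE.
      by rewrite ffunE; have /hspanP/(_ x xE) := vE; rewrite /hvec => ->; apply: mul0r.
    have -> : \sum_(x in E) (v x *: obasis K A (A i x)) (phi y) =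
              \sum_z (v (phi z) *: obasis K A (A i (phi z))) (phi y) :> K.
      have -> : E = phi @: [set: Y].
        by apply/setP => x; rewrite -phiE; apply/codomP/imsetP => [[z ->]|[z _ ->]];
          exists z.
      rewrite big_imset /= => [|? ? _ _ /phi_inj //].
      by apply: eq_bigl => z; rewrite inE.
    apply: eq_bigr => z _; rewrite !ffunE phiA; congr (_ *: _).
    by case: (B i z) => [w|] /=; rewrite !ffunE ?(inj_eq phi_inj).
  - by apply/ffunP => y; rewrite /pull /hvec !ffunE.
  - by rewrite -IHa // -IHb //; apply/ffunP => y; rewrite /pull /hvec !ffunE.
  - by rewrite IHa ?IHb //; apply: hspan_heval.
pose f (v : hsubmod K hE) : hmod K B := pull (hsubmod_val v).
have f_lin : linear f.
  move=> a u v; rewrite /f.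
  have -> : hsubmod_val (a *: u + v) = a *: hsubmod_val u + hsubmod_val v.
    by rewrite -[LHS]/(val (a *: u + v)) linearP.
  have -> : a *: pull (hsubmod_val u) = pull (a *: hsubmod_val u).
    by rewrite [LHS]/(hmod_scale _ _) -pull_heval //; apply: hsubmod_in.
  by apply/ffunP => y; rewrite /pull /hvec !ffunE.
pose fL := GRing.isLinear.Build _ _ _ _ f f_lin.
pose F : {linear hsubmod K hE -> hmod K B} := HB.pack f fL.
have FE v : F v = pull (hsubmod_val v) by [].
exists F.
pose push (u : hmod K B) : hmod K A := [ffun x => \sum_(y | phi y == x) hvec u y].
have push_in u : push u \in hspan_pred (K := K) hE.
  apply/hspanP => x xE; rewrite /hvec ffunE big1 // => y /eqP yx.
  by rewrite -yx phi_in in xE.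
exists (fun u => HSubmod (push_in u)) => [[v vE]|u].
  apply: val_inj => /=; apply/ffunP => x; rewrite ffunE.
  case: (boolP (x \in E)) => xE; last first.
    have /hspanP/(_ x xE) := vE; rewrite /hvec => ->.
    by rewrite big1 // => y /eqP yx; rewrite -yx phi_in in xE.
  move: (xE); rewrite -phiE => /codomP [y ->].
  rewrite (big_pred1 y) => [|z]; last exact: (inj_eq phi_inj).
  by rewrite /f /pull /hvec ffunE.
apply/ffunP => y; rewrite FE /pull /hvec ffunE /= /push ffunE.
by rewrite (big_pred1 y) // => z; rewrite (inj_eq phi_inj).
Qed.

(** * Left weak order *)

Section WeakOrderInduction.
Variable n : nat.
Implicit Types (i : 'I_n.-1) (g h : 'S_n).

Lemma leL_refl g : leL g g.
Proof.
by apply/existsP; exists 1%g; rewrite mulg1 eqxx /= !coxlen_ninv ninv1.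
Qed.

(** A reduced word of the left factor is a saturated chain: each letter has to
    raise the length, as the total length would otherwise fall short. *)
Lemma leL_ind (P : 'S_n -> Prop) g h :
    (forall i k, leL g k -> i \notin DesL k -> P k -> P (sref i \oS k)) ->
  leL g h -> P g -> P h.
Proof.
move=> step /existsP [a /andP [/eqP -> /eqP len]] Pg; move: len.
have [w [<- sz]] := coxlenP a; rewrite -{}sz => len.
suff : leL g (word_perm w \oS g) /\ P (word_perm w \oS g) by case.
elim: w len => [|i w IH] /=; first by rewrite mulg1 => _; split; first exact: leL_refl.
rewrite mulgA; set k := _ \oS g => len.
have lek : (coxlen k <= size w + coxlen g)%N.
  by apply: leq_trans (coxlenM _ _) _; rewrite leq_add2r coxlen_le.
case: (boolP (i \in DesL k)) => [/coxlen_desc|asc]; first by rewrite len; lia.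
have lenk : coxlen k = (size w + coxlen g)%N.
  by move: len; rewrite (coxlen_asc asc); lia.
have [gk Pk] := IH lenk; split; last exact: step.
by move: (leL_trans gk (leL_desact i k)); rewrite /desact (negPf asc).
Qed.

(** The step exchanges two consecutive values, which undoes an inversion only
    if the larger value comes first, that is, at a descent. *)
Lemma leL_inversion g h (p q : 'I_n) :
  leL g h -> (p < q)%N -> (g q < g p)%N -> (h q < h p)%N.
Proof.
move=> gh pq; apply: (leL_ind (P := fun k : 'S_n => (k q < k p)%N) _ gh) => i k _ asc qp.
rewrite !permM.
apply: sref_lt qp; apply: contra asc.
by rewrite xpair_eqE => /andP [/eqP eq /eqP ep]; rewrite DesLE -eq -ep !permK.
Qed.

End WeakOrderInduction.

(** * Permuted composition tableaux *)

Section Tableaux.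
Variables (n : nat) (alpha : composition n) (sigma : 'S_(size alpha)).
Implicit Types (b c d x y : box alpha) (i : 'I_n.-1) (t u : spct sigma).
Implicit Type E : {set spct sigma}.

Lemma box_left b k : (k <= bcol b)%N ->
  exists2 d : box alpha, brow d = brow b & bcol d = k.
Proof.
move=> kb; have kr : (k < nth 0%N alpha (tag b))%N.
  by apply: leq_ltn_trans kb (ltn_ord _).
by exists (Tagged (fun r : 'I_(size alpha) => 'I_(nth 0%N alpha r)) (Ordinal kr)).
Qed.

Lemma entry_lt_row t b c :
  brow b = brow c -> (bcol b < bcol c)%N -> (entry t c < entry t b)%N.
Proof.
move=> rbc cbc; have /and4P [_ _ /'forall_forallP rows _] := valP t.
by have := rows b c; rewrite rbc eqxx cbc.
Qed.

Lemma entry_triple t b c :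
    (brow b < brow c)%N -> bcol c = (bcol b).+1 -> (entry t c < entry t b)%N ->
  exists d, [/\ brow d = brow b, bcol d = bcol c & (entry t c < entry t d)%N].
Proof.
move=> rbc cbc tbc; have /and4P [_ _ _ /'forall_forallP tri] := valP t.
have := tri b c; rewrite rbc cbc eqxx tbc /= => /existsP [d /and3P [/eqP ? /eqP ? ?]].
by exists d.
Qed.

Lemma entry_ltNgt t b c : b <> c ->
  (entry t b < entry t c)%N = ~~ (entry t c < entry t b)%N.
Proof.
move=> bc; case: ltngtP => // e; case: bc; apply: (@entry_inj _ _ _ t).
exact: ord_inj.
Qed.

Lemma consecutive_letter t x y : entry t y = (entry t x).+1 :> nat ->
  exists i, lo i = entry t x /\ hi i = entry t y.
Proof.
move=> e; have lt : (entry t x < n.-1)%N by have := ltn_ord (entry t y); lia.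
by exists (Ordinal lt); split; apply: ord_inj.
Qed.

(** A box between the two would hold an entry strictly between consecutive
    integers. *)
Lemma row_consecutive t b c : brow c = brow b -> (bcol c < bcol b)%N ->
  entry t c = (entry t b).+1 :> nat -> bcol b = (bcol c).+1.
Proof.
move=> rcb ccb e; apply/eqP; rewrite eqn_leq ccb andbT leqNgt; apply/negP => lt.
have [d rd cd] := box_left ccb.
have := @entry_lt_row t c d _ _; have := @entry_lt_row t d b _ _.
by rewrite rd cd e => /(_ erefl lt) h1 /(_ rcb (ltnSn _)); lia.
Qed.

Definition swapped i t u : Prop := forall b, entry u b = sref i (entry t b).

Lemma swapped_lt i t u b c : swapped i t u ->
    (entry t b, entry t c) != (lo i, hi i) ->
  (entry t b < entry t c)%N -> (entry u b < entry u c)%N.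
Proof. by move=> tu ne lt; rewrite !tu; apply: sref_lt. Qed.

(** In the second case the columns differ because boxes of one column attack
    each other. *)
Lemma sact_cases i t u : sact i t = Some u ->
  [/\ (bcol (bpos t (hi i)) < bcol (bpos t (lo i)))%N & u = t] \/
  [/\ (bcol (bpos t (lo i)) < bcol (bpos t (hi i)))%N & swapped i t u].
Proof.
rewrite /sact; case: ifP => [lt [<-]|/negbT weak]; first by left.
case: ifP => // /negbT natt; case: insubP => // u' _ e [<-]; right.
split; last by move=> b; rewrite /entry e ffunE.
rewrite ltn_neqAle leqNgt weak andbT.
by move: natt; rewrite /attacking negb_or => /andP [].
Qed.

(** A swap exchanges i with an i + 1 that lies to its right, so it can only move
    the larger of two entries to the left: what lies further left and is larger
    stays larger. *)
Lemma left_greater_step i t u b c : sact i t = Some u -> (bcol b < bcol c)%N ->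
  (entry t c < entry t b)%N -> (entry u c < entry u b)%N.
Proof.
move=> /sact_cases [[_ -> //]|[weak tu]] bc; apply: (swapped_lt tu).
apply/eqP => -[/eqP ec /eqP eb]; move: weak.
by rewrite -(eqP ec) -(eqP eb) !entryK ltnNge ltnW.
Qed.

(** Only the relative order of b and c changes.  They differ in row and in column,
    so at most the triple condition compares them, namely if b is in the column
    to the right of c and lower; but its premise then fails in u, where the entry
    of c is the smaller one. *)
Lemma unswap i t b c : entry t b = lo i -> entry t c = hi i ->
    (bcol c < bcol b)%N -> brow c <> brow b ->
  exists2 u, spct_sim t u & swapped i t u.
Proof.
move=> tb tc ccb rcb.
(* Of an increasing pair, only b and c in this order can be reversed. *)
have ne x y : (bcol x <= bcol y)%N \/ brow x = brow y ->
    (entry t x, entry t y) != (lo i, hi i).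
  move=> h; apply/eqP => -[ex ey].
  have xb : x = b by apply: (@entry_inj _ _ _ t); rewrite ex tb.
  have yc : y = c by apply: (@entry_inj _ _ _ t); rewrite ey tc.
  by case: h; rewrite xb yc; [lia | move=> e; apply: rcb].
have lt x y : (bcol x <= bcol y)%N \/ brow x = brow y ->
    (entry t x < entry t y)%N -> (swap_filling t i x < swap_filling t i y)%N.
  by move=> h; rewrite !ffunE; apply: sref_lt; apply: ne.
have col x y : bcol x = bcol y ->
    (swap_filling t i x < swap_filling t i y)%N = (entry t x < entry t y)%N.
  move=> cxy; apply/idP/idP; last by apply: lt; left; rewrite cxy.
  case: (altP (x =P y)) => [->|/eqP xy]; first by rewrite ltnn.
  rewrite (entry_ltNgt t xy); apply: contraL => /lt h.
  by rewrite -leqNgt ltnW // h //; left; rewrite cxy.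
have sp : is_spct sigma (swap_filling t i).
  have /and4P [_ ty _ _] := valP t.
  apply/and4P; split.
  - apply/injectiveP => x y; rewrite !ffunE => /(inv_inj (sref_involutive i)).
    exact: entry_inj.
  - move: ty; rewrite /spct_type => /eqP <-; apply/eqP/standardization_eq.
      by rewrite !size_map.
    rewrite /first_column; set s := sort _ _ => k l.
    rewrite size_map => hk hl; rewrite !(nth_map b) //.
    have col0 m : (m < size s)%N -> bcol (nth b s m) = 0%N.
      by move=> /(mem_nth b); rewrite mem_sort mem_enum => /eqP.
    by apply: col; rewrite ?col0.
  - apply/'forall_forallP => x y; apply/implyP => /andP [/eqP rxy cxy].
    by apply: lt; [right | apply: entry_lt_row].
  - apply/'forall_forallP => x y; apply/implyP => /and3P [rxy /eqP cxy h].
    have xy : x <> y by move=> e; move: cxy; rewrite e; lia.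
    have h' : (entry t y < entry t x)%N.
      rewrite (entry_ltNgt t (nesym xy)); apply: contraL h => h.
      by rewrite -leqNgt ltnW // lt //; left; rewrite cxy.
    have [d [rd cd hd]] := entry_triple rxy cxy h'.
    by apply/existsP; exists d; rewrite rd cd cxy !eqxx col // cd.
pose u : spct sigma := Sub (swap_filling t i) sp; exists u.
  by apply/spct_simP => x y cxy; rewrite -col // /entry SubK.
by move=> x; rewrite /entry SubK ffunE.
Qed.

(** In adjacent columns, a reversal in u would, by the triple condition, put
    a larger entry than that of c to the right of b; comparing it with c down
    their common column gives the same in t, and since rows decrease, c would
    hold a smaller entry than b in t too. *)
Lemma box_attack_mono t u b c : spct_sim t u -> box_attack b c ->
  (entry t b < entry t c)%N -> (entry u b < entry u c)%N.
Proof.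
move=> /spct_simP tu /orP [/eqP cbc|/andP [/eqP cbc rbc]] tbc.
  by rewrite -tu.
have bc : b <> c by move=> e; move: cbc; rewrite e; lia.
rewrite (entry_ltNgt u bc); apply/negP => ucb.
have [d [rd cd ud]] := entry_triple rbc cbc ucb.
move: ud; rewrite -tu // => td.
by have := @entry_lt_row t b d (esym rd); rewrite cd cbc => /(_ (ltnSn _)); lia.
Qed.

Lemma class_sim E t u : E \in spct_classes sigma -> t \in E -> (u \in E) = spct_sim t u.
Proof.
case/imsetP => x _ ->; rewrite !inE /= => /spct_simP xt.
apply/spct_simP/spct_simP => h b c bc; first by rewrite -xt // h.
by rewrite xt // h.
Qed.

Lemma sact_class E i t u :
  E \in spct_classes sigma -> t \in E -> sact i t = Some u -> u \in E.
Proof. by move=> hE tE e; have := class_stable hE i tE; rewrite /= e. Qed.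

End Tableaux.

(** * The reading order *)

Lemma pairwise_flatten (T I : Type) (r : rel T) (F : I -> seq T) (s : seq I) :
    all (fun j => pairwise r (F j)) s ->
    pairwise (fun j k => allrel r (F j) (F k)) s ->
  pairwise r (flatten [seq F j | j <- s]).
Proof.
elim: s => //= j s IH /andP [rj rs] /andP [js ss].
rewrite pairwise_cat rj IH // !andbT; elim: s js {IH rs ss} => [|k s IH] /=.
  by rewrite allrel0r.
by case/andP=> jk js; rewrite allrel_catr jk IH.
Qed.

Section ReadingOrder.
Variables (n : nat) (alpha : composition n) (sigma : 'S_(size alpha)).
Variable tE : spct sigma.
Implicit Types (b c d x y : box alpha) (i : 'I_n.-1) (t u : spct sigma).

Local Notation boxes := (reading_boxes tE).

Lemma size_reading_boxes : size boxes = n.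
Proof. by rewrite (perm_size (reading_boxes_perm tE)) -cardE card_box. Qed.

Lemma mem_reading_boxes b : b \in boxes.
Proof. by rewrite (perm_mem (reading_boxes_perm tE)) mem_enum. Qed.

Lemma reading_pos_subproof b : (index b boxes < n)%N.
Proof. by rewrite -[X in (_ < X)%N]size_reading_boxes index_mem mem_reading_boxes. Qed.
Definition reading_pos b : 'I_n := Ordinal (reading_pos_subproof b).

Lemma reading_pos_inj : injective reading_pos.
Proof.
move=> b c /(congr1 val) /= e.
by rewrite -(nth_index b (mem_reading_boxes b)) e nth_index ?mem_reading_boxes.
Qed.

Lemma reading_perm_pos t b : reading_perm tE t (reading_pos b) = entry t b.
Proof.
rewrite permE reading_wordE (nth_map b) ?nth_index ?mem_reading_boxes //.
by rewrite index_mem mem_reading_boxes.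
Qed.

Lemma reading_perm_inv t v : (reading_perm tE t)^-1%g v = reading_pos (bpos t v).
Proof.
apply: (@perm_inj _ (reading_perm tE t)).
by rewrite permKV reading_perm_pos bposK.
Qed.

Lemma reading_perm_inj : injective (reading_perm tE).
Proof.
move=> t u e; apply: val_inj; apply/ffunP => b.
by have := reading_perm_pos u b; rewrite -e reading_perm_pos.
Qed.

Lemma reading_perm_swapped i t u :
  swapped i t u -> reading_perm tE u = sref i \oS reading_perm tE t.
Proof.
move=> tu; apply/permP => k; rewrite permM.
have -> : k = reading_pos (bpos t (reading_perm tE t k)) by rewrite -reading_perm_inv permK.
by rewrite !reading_perm_pos tu.
Qed.

Lemma mem_breaks t i : (i.+1 \in breaks t) =
  (bcol (bpos t (lo i)) <= bcol (bpos t (hi i)))%N.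
Proof.
rewrite /breaks in_cons /= mem_rcons in_cons.
have -> : (i.+1 == n) = false by apply/negbTE; have := ltn_ord i; lia.
apply/mapP/idP => [[k] |h]; last by exists i => //; rewrite mem_filter h mem_enum.
by rewrite mem_filter => /andP [h _] [/ord_inj ->].
Qed.

Lemma breaks_mono t j k :
  (j <= k)%N -> (k < size (breaks t))%N -> (nth 0 (breaks t) j <= nth 0 (breaks t) k)%N.
Proof.
move=> jk hk; apply: (sorted_leq_nth leq_trans leqnn) (breaks_sorted t) _ _ _ _ _ => //.
by rewrite inE; lia.
Qed.

(** Between two values without a break in between, each successor lies strictly
    further left than its predecessor. *)
Lemma no_break_col t b c : (entry t b < entry t c)%N ->
    (forall v, (entry t b < v <= entry t c)%N -> v \notin breaks t) ->
  (bcol c < bcol b)%N.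
Proof.
have [m] := ubnP (entry t c); elim: m c => // m IH c lt bc nobr.
have e1 : ((entry t c).-1 < n.-1)%N by have := ltn_ord (entry t c); lia.
pose i := Ordinal e1.
have hic : hi i = entry t c by apply: ord_inj => /=; lia.
have := mem_breaks t i; rewrite (negPf (nobr i.+1 _)) => [/esym/negbT|]; last first.
  by rewrite /=; lia.
rewrite -ltnNge hic entryK => ltc.
case: (ltngtP (entry t b) i) => [lti|gti|ei]; last first.
- by rewrite -(entryK t b) (_ : entry t b = lo i) //; apply: ord_inj.
- by move: gti => /=; lia.
have := IH (bpos t (lo i)); rewrite bposK => IHi.
apply: ltn_trans ltc _; apply: IHi => //=; first by lia.
by move=> v /= hv; apply: nobr; lia.
Qed.

Lemma mem_strip j b : (b \in strip_boxes tE j) =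
  (nth 0 (breaks tE) j.-1 < (entry tE b).+1 <= nth 0 (breaks tE) j)%N.
Proof. by rewrite mem_sort mem_enum inE. Qed.

(** What the rest of the proof uses about a box b read before a box c: an
    inversion goes strictly to the right, and a successor does not go to the
    left. *)
Definition reading_rel b c : bool :=
  [|| entry tE b < entry tE c | bcol b < bcol c]%N &&
  (((entry tE c : nat) == (entry tE b).+1) ==> (bcol b <= bcol c)%N).

Lemma strip_pairwise j : (0 < j < size (breaks tE))%N ->
  pairwise reading_rel (strip_boxes tE j).
Proof.
case/andP => j0 jsz.
have tot : total (fun b c : box alpha => bcol b <= bcol c)%N.
  by move=> b c; apply: leq_total.
have tr : transitive (fun b c : box alpha => bcol b <= bcol c)%N.
  by move=> b c d; apply: leq_trans.
have : pairwise (fun b c => (bcol b <= bcol c)%N && (b != c)) (strip_boxes tE j).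
  rewrite pairwise_relI -uniq_pairwise sort_uniq enum_uniq andbT.
  by rewrite -sorted_pairwise // sort_sorted.
apply: sub_in_pairwise (allss _) => b c; rewrite !mem_strip => hb hc /andP [cbc bc].
rewrite /reading_rel cbc implybT andbT.
case: ltngtP => //= [lt|/ord_inj /entry_inj e]; last by rewrite e eqxx in bc.
apply: no_break_col lt _ => v hv; apply/negP => vbr.
have := index_mem v (breaks tE); rewrite vbr; set k := index _ _ => ksz.
have vk : nth 0%N (breaks tE) k = v by apply: nth_index.
case: (ltnP k j) => kj.
  have : (nth 0 (breaks tE) k <= nth 0 (breaks tE) j.-1)%N by apply: breaks_mono; lia.
  by rewrite vk; lia.
have := breaks_mono kj ksz; rewrite vk; lia.
Qed.

(** The largest value of a strip is a break, so its successor lies weakly to the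
    right of it. *)
Lemma strips_allrel j k : (0 < j < k)%N -> (k < size (breaks tE))%N ->
  allrel reading_rel (strip_boxes tE j) (strip_boxes tE k).
Proof.
case/andP => j0 jk ksz; apply/allrelP => b c; rewrite !mem_strip => hb hc.
have mono : (nth 0 (breaks tE) j <= nth 0 (breaks tE) k.-1)%N.
  by apply: breaks_mono; lia.
have lt : (entry tE b < entry tE c)%N by lia.
rewrite /reading_rel lt /=; apply/implyP => /eqP /consecutive_letter [i [lb lc]].
have : i.+1 \in breaks tE.
  have -> : i.+1 = nth 0%N (breaks tE) j; last by apply: mem_nth; apply: ltn_trans ksz.
  have lb' : i = entry tE b :> nat by rewrite -lb.
  have lc' : i.+1 = entry tE c :> nat by rewrite -lc.
  lia.
by rewrite mem_breaks lb lc !entryK.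
Qed.

Lemma reading_pos_reading_rel b c : (reading_pos b < reading_pos c)%N -> reading_rel b c.
Proof.
have pw : pairwise reading_rel boxes.
  apply: pairwise_flatten.
    apply/allP => j; rewrite mem_iota => hj; apply: strip_pairwise.
    by move: hj; rewrite /breaks /=; lia.
  have : pairwise ltn (iota 1 (size (breaks tE)).-1).
    by rewrite -sorted_pairwise ?iota_ltn_sorted //; apply: ltn_trans.
  apply: sub_in_pairwise (allss _) => j k; rewrite !mem_iota => hj hk jk.
  by apply: strips_allrel; move: hj hk jk; rewrite /breaks /=; lia.
move=> /= bc; have /(pairwiseP b)/(_ (index b boxes) (index c boxes)) := pw.
by rewrite !inE !index_mem !mem_reading_boxes !nth_index ?mem_reading_boxes //; apply.
Qed.

End ReadingOrder.

(** * Tableaux between a source and a sink *)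

Section SourceSink.
Variables (K : fieldType) (n : nat) (alpha : composition n).
Variables (sigma : 'S_(size alpha)) (E : {set spct sigma}).
Hypothesis hE : E \in spct_classes sigma.
Variables tE tE' : spct sigma.
Hypotheses (srcE : is_source K E tE) (snkE : is_sink K E tE').
Implicit Types (b c d x y : box alpha) (i : 'I_n.-1) (t u : spct sigma).

Lemma source_in : tE \in E. Proof. by case: srcE. Qed.
Lemma sink_in : tE' \in E. Proof. by case: snkE. Qed.
#[local] Hint Resolve source_in sink_in : core.

Lemma class_ind (P : spct sigma -> Prop) t u (g : 'S_n) :
    (forall i (x y : spct sigma), x \in E -> sact i x = Some y -> P x -> P y) ->
    hecke_pi K g *: hbasis K (spct_action sigma) t = hbasis K (spct_action sigma) u ->
  t \in E -> P t -> P u.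
Proof.
move=> step e tin Pt.
have [_ //] : u \in E /\ P u.
apply: (hecke_pi_ind (P := fun z => z \in E /\ P z) _ e) => // i x y xy [xE Px].
by split; [apply: sact_class xy | apply: step xy Px].
Qed.

Lemma source_ind (P : spct sigma -> Prop) : P tE ->
    (forall i t u, t \in E -> sact i t = Some u -> P t -> P u) ->
  forall t, t \in E -> P t.
Proof.
move=> P0 step t tin; have [g e] := srcE.2 t tin.
exact: class_ind step e _ P0.
Qed.

Lemma left_greater_source t b c : t \in E -> (bcol b < bcol c)%N ->
  (entry tE c < entry tE b)%N -> (entry t c < entry t b)%N.
Proof.
move=> tin bc h.
apply: (source_ind (P := fun t => (entry t c < entry t b)%N) h _ tin) => i x y _ xy.
exact: left_greater_step xy bc.
Qed.

(** Otherwise the two boxes lie in different rows, and exchanging their entries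
    gives a tableau of the class in which the entry of b exceeds that of c.  But
    c is left of b and holds the larger entry in the source, so it does in every
    tableau of the class. *)
Lemma source_descent b c : entry tE c = (entry tE b).+1 :> nat ->
  (bcol b <= (bcol c).+1)%N.
Proof.
move=> e; rewrite leqNgt; apply/negP => ccb.
have ccb' : (bcol c < bcol b)%N by apply: ltnW.
have rcb : brow c <> brow b by move=> r; move: (row_consecutive r ccb' e) ccb; lia.
have [i [ib ic]] := consecutive_letter e.
have [u tu su] := unswap (esym ib) (esym ic) ccb' rcb.
have uE : u \in E by rewrite (class_sim u hE source_in).
have := left_greater_source uE ccb'; rewrite !su -ib -ic /sref tpermL tpermR /=.
by move=> /(_ (ltnSn _)); lia.
Qed.

(** Suppose that other values lie between those of b and c in tE.  Their boxes
    avoid the columns of b and c: from either column such a value would stay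
    between in t, since orders within a column are fixed and larger entries
    on the left persist.  Going up from the value of b, columns decrease by at
    most one at a time ([source_descent]), so they can never get past the
    forbidden columns to reach c. *)
Lemma source_row_consecutive t b c : t \in E ->
    brow c = brow b -> bcol b = (bcol c).+1 ->
  entry t c = (entry t b).+1 :> nat -> entry tE c = (entry tE b).+1 :> nat.
Proof.
move=> tin rcb cbc e.
have /spct_simP sim : spct_sim tE t by rewrite -(class_sim _ hE).
have lt0 : (entry tE b < entry tE c)%N by apply: entry_lt_row; rewrite // cbc.
have far x : (entry tE b < entry tE x < entry tE c)%N ->
    bcol x <> bcol b /\ bcol x <> bcol c.
  case/andP => bx xc; split=> cx.
    have := left_greater_source (b := c) (c := x) tin.
    rewrite cx cbc => /(_ (ltnSn _) xc); move: bx; rewrite sim // e; lia.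
  have := left_greater_source (b := x) (c := b) tin.
  rewrite cx cbc => /(_ (ltnSn _) bx); move: xc; rewrite sim // e; lia.
have [//|ne] := eqVneq (entry tE c : nat) (entry tE b).+1.
(* Starting in the column of b, the walk cannot cross the column of c. *)
have right k x : entry tE x = (entry tE b + k.+1)%N :> nat ->
    (entry tE x < entry tE c)%N -> (bcol b < bcol x)%N.
  elim: k x => [|k IH] x ex xc.
    have [] := far x _; first by lia.
    by have := @source_descent b x; lia.
  have lt : (entry tE b + k.+1 < n)%N by have := ltn_ord (entry tE x); lia.
  pose y := bpos tE (Ordinal lt).
  have ey : entry tE y = (entry tE b + k.+1)%N :> nat by rewrite bposK.
  have [] := far x _; first by lia.
  by have := IH y ey; have := @source_descent y x; lia.
have lt : ((entry tE c).-1 < n)%N by have := ltn_ord (entry tE c); lia.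
(* The value just below that of c lies right of b, at least two columns from c. *)
pose y := bpos tE (Ordinal lt).
have ey : entry tE y = (entry tE c).-1 :> nat by rewrite bposK.
have := right (entry tE c - entry tE b - 2)%N y; have := @source_descent y c.
by rewrite ey; lia.
Qed.

Local Notation read := (reading_perm tE).
Local Notation reading_pos := (reading_pos tE).

(** A swap creates exactly one new inversion, between boxes that it has found in
    increasing columns. *)
Lemma inversion_col t b c : t \in E -> (reading_pos b < reading_pos c)%N ->
  (entry t c < entry t b)%N -> (bcol b < bcol c)%N.
Proof.
move=> tin bc.
apply: (source_ind (P := fun t => (entry t c < entry t b)%N -> (bcol b < bcol c)%N)
  _ _ tin).
  by have /andP [/orP [lt|//] _] := reading_pos_reading_rel bc; move=> ?; lia.
move=> i x y _ /sact_cases [[_ -> //]|[weak xy]] IH ycb.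
have nbc : b <> c by move=> e; move: bc; rewrite e ltnn.
have [/IH //|xbc] := ltnP (entry x c) (entry x b).
have xbc' : (entry x b < entry x c)%N by rewrite (entry_ltNgt x nbc) -leqNgt.
have := swapped_lt xy _ xbc'; case: eqP => [[eb ec] _|_ /(_ isT)]; last by lia.
by move: weak; rewrite -eb -ec !entryK.
Qed.

(** A box of i read before a box of i + 1 further left is excluded by the
    reading order of the source if they share a row, and by [inversion_col] for
    the tableau with the two entries exchanged if they do not. *)
Lemma DesL_reading t i : t \in E ->
  (i \in DesL (read t)) = (bcol (bpos t (hi i)) < bcol (bpos t (lo i)))%N.
Proof.
move=> tin; rewrite DesLE !reading_perm_inv; apply/idP/idP => [lt|ccb].
  by apply: inversion_col tin lt _; rewrite !bposK.
set b := bpos t (lo i) in ccb *; set c := bpos t (hi i) in ccb *.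
have e : entry t c = (entry t b).+1 :> nat by rewrite !bposK.
rewrite ltnNge leq_eqVlt negb_or; apply/andP; split.
  by apply/eqP => /ord_inj /reading_pos_inj ecb; move: e; rewrite ecb; lia.
apply/negP => lt; have [rcb|rcb] := eqVneq (brow c) (brow b).
  have eE := source_row_consecutive tin rcb (row_consecutive rcb ccb e) e.
  by have /andP [_] := reading_pos_reading_rel lt; rewrite eE eqxx leqNgt ccb.
have [u tu su] := unswap (bposK _ _) (bposK _ _) ccb (elimN eqP rcb).
have uE : u \in E by rewrite (class_sim u hE tin).
have := inversion_col uE lt; rewrite !su !bposK /sref tpermL tpermR => /(_ (ltnSn _)).
by move=> h; have := ltn_trans h ccb; rewrite ltnn.
Qed.

Lemma reading_sact t u i : t \in E -> sact i t = Some u -> read u = desact i (read t).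
Proof.
move=> tin /sact_cases; rewrite /desact (DesL_reading i tin).
case=> [[-> -> //]|[lt tu]].
by rewrite ltnNge ltnW //=; apply: reading_perm_swapped.
Qed.

Lemma leL_reading_step i t u v : t \in E -> sact i t = Some u ->
  leL v (read t) -> leL v (read u).
Proof.
by move=> tin tu vt; rewrite (reading_sact tin tu); apply: leL_desact2.
Qed.

Lemma leL_source t : t \in E -> leL (read tE) (read t).
Proof.
move=> tin; apply: (source_ind (P := fun t => leL (read tE) (read t)) _ _ tin).
  exact: leL_refl.
by move=> i x y; apply: leL_reading_step.
Qed.

Lemma leL_sink t : t \in E -> leL (read t) (read tE').
Proof.
move=> tin; have [g e] := snkE.2 t tin.
apply: (class_ind (P := fun z => leL (read t) (read z)) _ e) => //.
  by move=> i x y; apply: leL_reading_step.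
exact: leL_refl.
Qed.

(** Having s_i read t below read u would force an inversion of u at the boxes of
    i and i + 1, whose order is the same throughout the class. *)
Lemma attacking_leL t u i : t \in E -> u \in E -> i \notin DesL (read t) ->
  attacking t i -> ~~ leL (sref i \oS read t) (read u).
Proof.
move=> tin uE asc att; apply/negP => le.
set b := bpos t (lo i) in att; set c := bpos t (hi i) in att.
have bc : (reading_pos b < reading_pos c)%N.
  move: asc; rewrite DesLE !reading_perm_inv -leqNgt leq_eqVlt => /orP [|//].
  move=> /eqP /ord_inj /reading_pos_inj /(congr1 (entry t)); rewrite !bposK.
  by move/eqP; rewrite (negPf (lo_neq_hi i)).
have := leL_inversion le bc; rewrite !permM !reading_perm_pos !bposK.
rewrite /sref tpermL tpermR => /(_ (ltnSn _)).
have sim : spct_sim t u by rewrite -(class_sim _ hE tin).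
have := box_attack_mono (b := b) (c := c) sim att; rewrite !bposK => /(_ (ltnSn _)); lia.
Qed.

(** A step up inside the interval is never at a descent and, by
    [attacking_leL], never at an attacking pair: it is a swap of tableaux. *)
Lemma interval_reading g : leL (read tE) g -> leL g (read tE') ->
  exists2 t, t \in E & read t = g.
Proof.
move=> leg; apply: (leL_ind (P := fun g => leL g (read tE') ->
  exists2 t, t \in E & read t = g) _ leg); last by exists tE.
move=> i k _ asc IH le.
have kle : leL k (sref i \oS k).
  by move: (leL_desact i k); rewrite /desact (negPf asc).
have [t tin rt] := IH (leL_trans kle le).
rewrite -rt in asc le *.
have natt : ~~ attacking t i.
  by apply/negP => /(attacking_leL tin sink_in asc); rewrite le.
have weak : (bcol (bpos t (lo i)) <= bcol (bpos t (hi i)))%N.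
  by rewrite leqNgt -DesL_reading.
have [u tu _] := sact_swap natt weak.
exists u; first exact: sact_class tu.
by rewrite (reading_sact tin tu) /desact (negPf asc).
Qed.

Lemma Smod_class_iso : exists f : {linear Smod_class K hE ->
    Bmod K (read tE) (read tE')}, bijective f.
Proof.
have ex (g : intervalL (read tE) (read tE')) :
    exists t, t \in E /\ read t = val g.
  by case/andP: (valP g) => /interval_reading h /h [t ? ?]; exists t.
have [phi phiP] := fin_all_exists ex.
have phiE g : phi g \in E := (phiP g).1.
have phiK g : read (phi g) = val g := (phiP g).2.
have phi_read t g : read t = val g -> t = phi g.
  by rewrite -phiK => /reading_perm_inj.
apply: (@hsubmod_iso _ _ _ _ _ _ _ _ phi).
- by move=> g h e; apply: val_inj; rewrite -!phiK e.
- move=> t; apply/codomP/idP => [[g ->] //|tin].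
  have gP : leL (read tE) (read t) && leL (read t) (read tE').
    by rewrite leL_source ?leL_sink.
  by exists (Sub (read t) gP); apply: phi_read; rewrite SubK.
- move=> i g /=; rewrite /bact -phiK (DesL_reading i (phiE g)).
  rewrite /sact; case: ifP => [//|/negbT weak]; rewrite -leqNgt in weak.
  have asc : i \notin DesL (read (phi g)) by rewrite DesL_reading // -leqNgt.
  case: ifP => [att|/negbT natt].
    rewrite insubF //; apply/negbTE; rewrite negb_and.
    by rewrite [X in _ || X](attacking_leL (phiE g) sink_in asc att) orbT.
  have [u tu _] := sact_swap natt weak.
  have uE := sact_class hE (phiE g) tu.
  have ru : read u = sref i \oS read (phi g).
    by rewrite (reading_sact (phiE g) tu) /desact (negPf asc).
  move: tu; rewrite /sact ltnNge weak /= (negPf natt) => ->.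
  have gP : leL (read tE) (read u) && leL (read u) (read tE').
    by rewrite leL_source ?leL_sink.
  by rewrite -ru insubT /=; congr Some; apply: phi_read; rewrite SubK.
Qed.

End SourceSink.

Theorem theorem4p8 (R : realType) (n : nat) (alpha : composition n)
    (sigma : 'S_(size alpha)) (E : {set spct sigma})
    (hE : E \in spct_classes sigma) (tauE tauE' : spct sigma) :
  is_source R[i] E tauE -> is_sink R[i] E tauE' ->
  exists f : {linear Smod_class R[i] hE ->
                Bmod R[i] (reading_perm tauE tauE) (reading_perm tauE tauE')},
    bijective f.
Proof. exact: Smod_class_iso. Qed.
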